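(* Let $K$ be a Valdivia compact space admitting a $G_\delta$ point $x$ (i.e., $\{x\}$ is a countable intersection of open sets) with $w(x,K)\ge\mathfrak c$. Then there exists a nontrivial twisted sum of $c_0$ and $C(K)$. In particular, assuming the Continuum Hypothesis, if $K$ is a Valdivia compact space admitting a $G_\delta$ point having no second countable neighborhood, then there exists a nontrivial twisted sum of $c_0$ and $C(K)$.
   Context: For a compact Hausdorff space $K$, $C(K)$ is the Banach space of continuous real-valued functions on $K$ with the supremum norm; $c_0$ is the Banach space of real sequences converging to zero. For Banach spaces $Y,X$, a twisted sum of $Y$ and $X$ is a short exact sequence $0\to Y\to Z\to X\to 0$ with $Z$ a Banach space and bounded linear maps; it is trivial if the image of $Y\to Z$ is complemented in $Z$. $\mathfrak c$ is the cardinality of the continuum. For an index set $I$, $\Sigma(I)=\{x\in\mathbb R^I:\{i: x_i\neq0\}\text{ is countable}\}$. A subset $A$ of a compact Hausdorff space $K$ is a $\Sigma$-subset if there exist an index set $I$ and a continuous injection $\varphi:K\to\mathbb R^I$ with $A=\varphi^{-1}[\Sigma(I)]$; $K$ is a Valdivia compactum if it admits a dense $\Sigma$-subset. For a point $x$ of a space $\mathcal X$, $w(x,\mathcal X)=\min\{w(V): V\text{ a neighborhood of }x\text{ in }\mathcal X\}$, where $w(V)$ is the weight (minimal cardinality of a base) of $V$. *)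

(* Defs.v *)
From Stdlib Require Import Reals.
Open Scope R_scope.

Definition countable_set {I : Type} (P : I -> Prop) : Prop :=
  exists f : I -> nat, forall i j, P i -> P j -> f i = f j -> i = j.

Definition set_eq {T : Type} (A B : T -> Prop) : Prop := forall t, A t <-> B t.

Record Topology (T : Type) := {
  is_open : (T -> Prop) -> Prop;
  open_ext : forall U V, set_eq U V -> is_open U -> is_open V;
  open_full : is_open (fun _ => True);
  open_inter : forall U V, is_open U -> is_open V -> is_open (fun t => U t /\ V t);
  open_union : forall F : (T -> Prop) -> Prop,
      (forall U, F U -> is_open U) -> is_open (fun t => exists U, F U /\ U t)
}.
Arguments is_open {T} t U.

Definition hausdorff {T : Type} (tau : Topology T) : Prop :=
  forall x y : T, x <> y ->
    exists U V, is_open tau U /\ is_open tau V /\ U x /\ V y /\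
                (forall t, U t -> V t -> False).

Definition compact {T : Type} (tau : Topology T) : Prop :=
  forall F : (T -> Prop) -> Prop,
    (forall U, F U -> is_open tau U) ->
    (forall t, exists U, F U /\ U t) ->
    exists l : list (T -> Prop),
      (forall U, List.In U l -> F U) /\ (forall t, exists U, List.In U l /\ U t).

Definition continuous_R {T : Type} (tau : Topology T) (f : T -> R) : Prop :=
  forall (k : T) (eps : R), 0 < eps ->
    exists U, is_open tau U /\ U k /\ forall y, U y -> Rabs (f y - f k) < eps.

Definition dense {T : Type} (tau : Topology T) (A : T -> Prop) : Prop :=
  forall U, is_open tau U -> (exists t, U t) -> exists t, U t /\ A t.

Definition Sigma_pt {I : Type} (y : I -> R) : Prop :=
  countable_set (fun i => y i <> 0).

(* Valdivia compactum: a continuous injection phi : K -> R^I (product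
   topology; continuity = continuity of every coordinate) such that
   phi^{-1}[Sigma(I)] is dense in K. *)
Definition valdivia {K : Type} (tau : Topology K) : Prop :=
  compact tau /\ hausdorff tau /\
  exists (I : Type) (phi : K -> I -> R),
    (forall i, continuous_R tau (fun k => phi k i)) /\
    (forall k1 k2, (forall i, phi k1 i = phi k2 i) -> k1 = k2) /\
    dense tau (fun k => Sigma_pt (phi k)).

Definition Gdelta_point {K : Type} (tau : Topology K) (x : K) : Prop :=
  exists U : nat -> K -> Prop,
    (forall n, is_open tau (U n)) /\
    (forall t, (forall n, U n t) <-> t = x).

Definition neighborhood {K : Type} (tau : Topology K) (V : K -> Prop) (x : K) : Prop :=
  exists U, is_open tau U /\ U x /\ forall t, U t -> V t.

Definition subspace_base {K : Type} (tau : Topology K) (V : K -> Prop)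
    (B : (K -> Prop) -> Prop) : Prop :=
  (forall W, B W -> exists U, is_open tau U /\ set_eq W (fun t => U t /\ V t)) /\
  (forall U, is_open tau U -> forall y, U y -> V y ->
     exists W, B W /\ W y /\ forall t, W t -> U t /\ V t).

Definition weight_ge_c {K : Type} (tau : Topology K) (V : K -> Prop) : Prop :=
  forall B, subspace_base tau V B ->
    exists f : R -> (K -> Prop),
      (forall r, B (f r)) /\ (forall r s, set_eq (f r) (f s) -> r = s).

Definition local_weight_ge_c {K : Type} (tau : Topology K) (x : K) : Prop :=
  forall V, neighborhood tau V x -> weight_ge_c tau V.

Definition second_countable_sub {K : Type} (tau : Topology K) (V : K -> Prop) : Prop :=
  exists g : nat -> (K -> Prop), subspace_base tau V (fun W => exists n, W = g n).

Definition CH : Prop :=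
  forall S : R -> Prop, countable_set S \/
    exists f : R -> R, (forall r, S (f r)) /\ (forall r s, f r = f s -> r = s).

Record Banach := {
  bcar :> Type;
  bzero : bcar;
  badd : bcar -> bcar -> bcar;
  bopp : bcar -> bcar;
  bscal : R -> bcar -> bcar;
  bnorm : bcar -> R;
  badd_assoc : forall x y z, badd x (badd y z) = badd (badd x y) z;
  badd_comm : forall x y, badd x y = badd y x;
  badd_0 : forall x, badd x bzero = x;
  badd_opp : forall x, badd x (bopp x) = bzero;
  bscal_addr : forall a x y, bscal a (badd x y) = badd (bscal a x) (bscal a y);
  bscal_addl : forall a b x, bscal (a + b) x = badd (bscal a x) (bscal b x);
  bscal_mul : forall a b x, bscal a (bscal b x) = bscal (a * b) x;
  bscal_1 : forall x, bscal 1 x = x;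
  bnorm_eq0 : forall x, bnorm x = 0 -> x = bzero;
  bnorm_scal : forall a x, bnorm (bscal a x) = Rabs a * bnorm x;
  bnorm_triangle : forall x y, bnorm (badd x y) <= bnorm x + bnorm y;
  bcomplete : forall u : nat -> bcar,
    (forall eps, 0 < eps -> exists N, forall m n, (N <= m)%nat -> (N <= n)%nat ->
        bnorm (badd (u m) (bopp (u n))) < eps) ->
    exists l, forall eps, 0 < eps -> exists N, forall n, (N <= n)%nat ->
        bnorm (badd (u n) (bopp l)) < eps
}.
Arguments bzero {b0}. Arguments badd {b0}. Arguments bopp {b0}.
Arguments bscal {b0}. Arguments bnorm {b0}.

Definition in_c0 (s : nat -> R) : Prop := Un_cv s 0.

(* Twisted sum 0 -> c0 --j--> Z --q--> C(K) -> 0 with bounded linear maps.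
   j is given on all sequences but only its values on c0 matter;
   q z is a function on K, required to be continuous. *)
Definition twisted_sum {K : Type} (tau : Topology K) (Z : Banach)
    (j : (nat -> R) -> Z) (q : Z -> K -> R) : Prop :=
  (forall a s t, in_c0 s -> in_c0 t ->
     j (fun n => a * s n + t n) = badd (bscal a (j s)) (j t)) /\
  (exists M, forall s b, in_c0 s -> (forall n, Rabs (s n) <= b) -> bnorm (j s) <= M * b) /\
  (forall s t, in_c0 s -> in_c0 t -> j s = j t -> forall n, s n = t n) /\
  (forall z, continuous_R tau (q z)) /\
  (forall a z w k, q (badd (bscal a z) w) k = a * q z k + q w k) /\
  (exists M, forall z k, Rabs (q z k) <= M * bnorm z) /\
  (forall f, continuous_R tau f -> exists z, forall k, q z k = f k) /\
  (forall z, (forall k, q z k = 0) <-> exists s, in_c0 s /\ z = j s).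

Definition complemented (Z : Banach) (Y : Z -> Prop) : Prop :=
  exists W : Z -> Prop,
    W bzero /\
    (forall a w1 w2, W w1 -> W w2 -> W (badd (bscal a w1) w2)) /\
    (forall (u : nat -> Z) l, (forall n, W (u n)) ->
       (forall eps, 0 < eps -> exists N, forall n, (N <= n)%nat ->
          bnorm (badd (u n) (bopp l)) < eps) -> W l) /\
    (forall z, exists y w, Y y /\ W w /\ z = badd y w) /\
    (forall z, Y z -> W z -> z = bzero).

Definition nontrivial_twisted_sum_c0_CK {K : Type} (tau : Topology K) : Prop :=
  exists (Z : Banach) (j : (nat -> R) -> Z) (q : Z -> K -> R),
    twisted_sum tau Z j q /\
    ~ complemented Z (fun z => exists s, in_c0 s /\ z = j s).

(* Main.v *)
(** The twisted sum is the pull-back of [0 -> c_0 -> l_oo -> l_oo/c_0 -> 0] along an operator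
    [T : C(K) -> l_oo/c_0], [T g = sum_(n,x) (g u_(n,x) - g v_(n,x)) 1_(A_(n,x))], where
    [(A_(n,x))] is an almost disjoint family of sets of integers and the differences
    [g u_(n,x) - g v_(n,x)] form a null family for every [g] in [C(K)].

    The set [A_(n,x)] is the branch of [x : nat -> nat] in the tree of finite sequences, used only
    if [liminf x = n].  By a Baire category argument, whatever finite part is removed from each
    branch, some node lies on remaining branches for arbitrarily many [n].  If the twisted sum
    were trivial, [T] would lift to a bounded operator into [l_oo]; evaluating it at such a node on
    a sum of functions [f_(n,x)] with [f u - f v = 1], with disjoint supports for distinct [n],
    gives arbitrarily large values.

    The points [u_(n,x) <> v_(n,x)] lie in disjoint annuli shrinking to the G_delta point and, for
    fixed [n], the sets of coordinates separating [u_(n,x)] from [v_(n,x)] are pairwise disjoint.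
    They come from a maximal family of such pairs near the point: the coordinates generated by the
    family support a retraction [r] of [K], and by maximality every point of the dense
    Sigma-subset near the G_delta point is fixed by [r] (otherwise [(a, r a)] could be added).  So
    the weight of a neighbourhood is at most the size of the family, which is therefore at least
    the continuum, and Koenig's theorem puts continuum many of the pairs in one annulus. *)

From Stdlib Require Import Reals Lra Lia List FinFun.
From Stdlib Require Import Classical ClassicalEpsilon FunctionalExtensionality PropExtensionality.
From mathcomp Require boolp classical_sets choice.
Require Import Defs.
Import ListNotations.

(** * Cardinality *)

(** [ZL_preorder] expects a boolean relation, which [asbool] supplies. Each use below orders partial
    objects by extension. *)
Lemma zorn_preorder (T : Type) (t0 : T) (R : T -> T -> Prop) :
  (forall t, R t t) -> (forall r s t, R r s -> R s t -> R r t) ->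
  (forall A : T -> Prop, (forall s t, A s -> A t -> R s t \/ R t s) ->
     exists t, forall s, A s -> R s t) ->
  exists t, forall s, R t s -> R s t.
Proof.
  intros Hr Ht Hc.
  destruct (@classical_sets.ZL_preorder T t0 (fun x y => boolp.asbool (R x y))) as [t Hm].
  - intros t; apply boolp.asboolT; auto.
  - intros r s t H1 H2; apply boolp.asboolT.
    exact (Ht _ _ _ (boolp.asboolW H1) (boolp.asboolW H2)).
  - intros A HA. destruct (Hc A) as [t Hub].
    + intros s t Hs Hts. destruct (HA s t Hs Hts) as [H|H];
        [left|right]; exact (boolp.asboolW H).
    + exists t. intros s Hs. apply boolp.asboolT; auto.
  - exists t. intros s Hs. apply boolp.asboolW. apply Hm. apply boolp.asboolT; exact Hs.
Qed.

Definition embeds (A B : Type) : Prop := exists f : A -> B, Injective f.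

Lemma embeds_trans (A B C : Type) : embeds A B -> embeds B C -> embeds A C.
Proof.
  intros [f Hf] [g Hg]. exists (fun x => g (f x)). intros x y H. auto.
Qed.

Lemma embeds_list (A B : Type) : embeds A B -> embeds (list A) (list B).
Proof.
  intros [f Hf]. exists (map f). intros l. induction l as [|a l IH]; intros [|b m] H;
    try discriminate; auto.
  injection H as H1 H2. f_equal; auto.
Qed.

(** Zorn on graphs of partial injections: a maximal graph is total or onto, since otherwise a pair
    of missed elements could be added. *)
Lemma embeds_comparable (A B : Type) : embeds A B \/ embeds B A.
Proof.
  set (ok := fun G : A -> B -> Prop =>
    (forall a b b', G a b -> G a b' -> b = b') /\
    (forall a a' b, G a b -> G a' b -> a = a')).
  assert (Hok0 : ok (fun _ _ => False)) by (split; intros; tauto).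
  destruct (zorn_preorder { G | ok G } (exist _ _ Hok0)
    (fun G H => forall a b, proj1_sig G a b -> proj1_sig H a b)) as [[G HG] Hmax].
  - auto.
  - auto.
  - intros F HF.
    assert (Hu : ok (fun a b => exists G, F G /\ proj1_sig G a b)).
    { split.
      - intros a b b' [G [HG1 HG2]] [H [HH1 HH2]].
        destruct (HF _ _ HG1 HH1) as [L|L];
          [destruct H as [H [H1 H2]] | destruct G as [G [H1 H2]]]; simpl in *; eapply H1; eauto.
      - intros a b b' [G [HG1 HG2]] [H [HH1 HH2]].
        destruct (HF _ _ HG1 HH1) as [L|L];
          [destruct H as [H [H1 H2]] | destruct G as [G [H1 H2]]]; simpl in *; eapply H2; eauto. }
    exists (exist _ _ Hu). intros s Hs a b Hab. exists s; auto.
  - simpl in Hmax.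
    destruct (classic (forall a, exists b, G a b)) as [H|H].
    { left. apply choice in H. destruct H as [f Hf]. exists f.
      intros a a' E. apply (proj2 HG a a' (f a)); auto. rewrite E; auto. }
    destruct (classic (forall b, exists a, G a b)) as [H'|H'].
    { right. apply choice in H'. destruct H' as [f Hf]. exists f.
      intros b b' E. apply (proj1 HG (f b)); auto. rewrite E; auto. }
    exfalso. apply not_all_ex_not in H. destruct H as [a Ha].
    apply not_all_ex_not in H'. destruct H' as [b Hb].
    assert (Hn : ok (fun x y => G x y \/ (x = a /\ y = b))).
    { destruct HG as [G1 G2]. split.
      - intros x y y' [H1|[? ?]] [H2|[? ?]]; subst; eauto; exfalso; eauto.
      - intros x x' y [H1|[? ?]] [H2|[? ?]]; subst; eauto; exfalso; eauto. }
    apply Ha. exists b. apply (Hmax (exist _ _ Hn)); simpl; auto.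
Qed.

(* Zorn on pairs [(Y, f)] with [f] injecting [list Y] into [Y]: a maximal [Y] has at least
   as many points as its complement, for otherwise a disjoint copy of [Y] could be added. *)
Lemma list_embeds (X : Type) : embeds nat X -> embeds (list X) X.
Proof.
  intros [e He].
  set (all := fun (Y : X -> Prop) l => forall y, In y l -> Y y).
  set (ok := fun Yf : (X -> Prop) * (list X -> X) =>
    (forall n, fst Yf (e n)) /\
    (forall l, all (fst Yf) l -> fst Yf (snd Yf l)) /\
    (forall l m, all (fst Yf) l -> all (fst Yf) m -> snd Yf l = snd Yf m -> l = m)).
  assert (H0 : exists f0, ok (fun y => exists n, y = e n, f0)).
  { assert (Hinv : exists d : X -> nat, forall n, d (e n) = n).
    { exists (fun x => epsilon (inhabits 0%nat) (fun n => e n = x)).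
      intros n. apply He. apply (epsilon_spec (inhabits 0%nat) (fun m => e m = e n)).
      exists n; auto. }
    destruct Hinv as [d Hd].
    (* The initial [Y] is the copy of [nat] given by [e], where the coding of lists of integers by
       integers serves as [f]. *)
    exists (fun l => e (choice.CodeSeq.code (map d l))). split; [|split]; simpl.
    - eauto.
    - eauto.
    - intros l m Hl Hm E. apply He in E.
      apply (f_equal choice.CodeSeq.decode) in E. rewrite !choice.CodeSeq.codeK in E.
      revert m Hm E. induction l as [|a l IH]; intros [|b m] Hm E; try discriminate; auto.
      injection E as E1 E2. f_equal.
      + destruct (Hl a) as [n ->]; [left; auto|]. destruct (Hm b) as [n' ->]; [left; auto|].
        rewrite !Hd in E1. congruence.
      + apply IH; auto. { intros y Hy; apply Hl; right; auto. }
        intros y Hy; apply Hm; right; auto. }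
  destruct H0 as [f0 Hf0].
  destruct (zorn_preorder { Yf | ok Yf } (exist _ _ Hf0)
    (fun P Q => (forall y, fst (proj1_sig P) y -> fst (proj1_sig Q) y) /\
       forall l, all (fst (proj1_sig P)) l -> snd (proj1_sig P) l = snd (proj1_sig Q) l))
    as [[[Y f] [Hn [HY Hf]]] Hmax].
  - intros t; auto.
  - intros r s t [H1 H2] [H3 H4]. split; auto. intros l Hl. rewrite H2, H4; auto.
    intros y Hy. auto.
  - intros F HF. destruct (classic (exists P, F P)) as [[P0 HP0]|Hemp].
    2:{ exists (exist _ _ Hf0). intros s Hs. exfalso; eauto. }
    set (Yu := fun y => exists P, F P /\ fst (proj1_sig P) y).
    assert (Hall : forall l, all Yu l -> exists P, F P /\ all (fst (proj1_sig P)) l).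
    { induction l as [|a l IH]; intros Hl.
      - exists P0. split; auto. intros y [].
      - destruct IH as [P [HP1 HP2]]. { intros y Hy; apply Hl; right; auto. }
        destruct (Hl a) as [Q [HQ1 HQ2]]; [left; auto|].
        destruct (HF _ _ HP1 HQ1) as [[L _]|[L _]].
        + exists Q. split; auto. intros y [<-|Hy]; auto.
        + exists P. split; auto. intros y [<-|Hy]; auto. }
    (* Along a chain, any two members containing [l] assign it the same value, so the choice of [P]
       does not matter. *)
    set (fu := fun l => epsilon (inhabits (e 0%nat))
      (fun z => exists P, F P /\ all (fst (proj1_sig P)) l /\ z = snd (proj1_sig P) l)).
    assert (Hfu : forall P l, F P -> all (fst (proj1_sig P)) l -> fu l = snd (proj1_sig P) l).
    { intros P l HP Hl. unfold fu.
      destruct (epsilon_spec (inhabits (e 0%nat))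
        (fun z => exists P, F P /\ all (fst (proj1_sig P)) l /\ z = snd (proj1_sig P) l))
        as [Q [HQ [HQl ->]]].
      { exists (snd (proj1_sig P) l). eauto. }
      destruct (HF _ _ HP HQ) as [[_ L]|[_ L]]; [symmetry|]; apply L; auto. }
    assert (Hu : ok (Yu, fu)).
    { split; [|split]; simpl.
      - intros n. exists P0. split; auto. apply (proj2_sig P0).
      - intros l Hl. destruct (Hall l Hl) as [P [HP HPl]].
        rewrite (Hfu P l HP HPl). exists P. split; auto. apply (proj2_sig P); auto.
      - intros l m Hl Hm. destruct (Hall l Hl) as [P [HP HPl]].
        destruct (Hall m Hm) as [Q [HQ HQm]].
        destruct (HF _ _ HP HQ) as [[L _]|[L _]].
        + assert (HQl : all (fst (proj1_sig Q)) l) by (intros y Hy; auto).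
          rewrite (Hfu Q l), (Hfu Q m); auto. apply (proj2_sig Q); auto.
        + assert (HPm : all (fst (proj1_sig P)) m) by (intros y Hy; auto).
          rewrite (Hfu P l), (Hfu P m); auto. apply (proj2_sig P); auto. }
    exists (exist _ _ Hu). intros P HP. simpl. split.
    + intros y Hy. exists P; auto.
    + intros l Hl. symmetry; auto.
  - simpl in *.
    assert (Hpair : forall y, Y y -> all Y [y; y]) by (intros y Hy z [<-|[<-|[]]]; auto).
    assert (Hone : forall y, Y y -> all Y [y]) by (intros y Hy z [<-|[]]; auto).
    destruct (embeds_comparable { y | ~ Y y } { y | Y y }) as [[c Hc]|[c Hc]].
    (* If the complement embeds in [Y], points of [X] become lists over [Y], of length 1 or 2
       according to whether they lie in [Y], and two applications of [f] finish. *)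
    + set (g := fun x => match excluded_middle_informative (Y x) with
        | left _ => [x]
        | right Hx => let z := proj1_sig (c (exist _ x Hx)) in [z; z] end).
      assert (Hg : forall x, all Y (g x)).
      { intros x. unfold g. destruct (excluded_middle_informative (Y x)) as [Hx|Hx]; auto.
        apply Hpair, (proj2_sig (c (exist _ x Hx))). }
      assert (Hgi : Injective g).
      { intros x y. unfold g.
        destruct (excluded_middle_informative (Y x)) as [Hx|Hx],
          (excluded_middle_informative (Y y)) as [Hy|Hy]; intros E; try discriminate.
        - congruence.
        - injection E as E _.
          assert (E' : c (exist _ x Hx) = c (exist _ y Hy)).
          { destruct (c (exist _ x Hx)), (c (exist _ y Hy)); simpl in E; subst.
            f_equal. apply proof_irrelevance. }
          apply Hc in E'. congruence. }
      exists (fun l => f (map (fun x => f (g x)) l)).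
      assert (Hm : forall l, all Y (map (fun x => f (g x)) l)).
      { intros l y Hy. apply in_map_iff in Hy. destruct Hy as [x [<- _]]. auto. }
      intros l m E. apply Hf in E; auto. revert m E.
      induction l as [|a l IH]; intros [|b m] E; try discriminate; auto.
      injection E as E1 E2. f_equal; auto.
    + exfalso.
      (* Otherwise [e'] maps [Y] onto a disjoint copy. The map [k] sends the union [Y'] injectively
         into [Y], and lists not lying in [Y] get values in the copy, so [f] extends to [Y']. *)
      set (e' := fun y => match excluded_middle_informative (Y y) with
        | left H => proj1_sig (c (exist _ y H)) | right _ => y end).
      assert (He1 : forall y, Y y -> ~ Y (e' y)).
      { intros y Hy. unfold e'. destruct (excluded_middle_informative (Y y)); try tauto.
        apply (proj2_sig (c (exist _ y y0))). }
      assert (He2 : forall y z, Y y -> Y z -> e' y = e' z -> y = z).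
      { intros y z Hy Hz. unfold e'.
        destruct (excluded_middle_informative (Y y)) as [H1|]; try tauto.
        destruct (excluded_middle_informative (Y z)) as [H2|]; try tauto. intros E.
        assert (E' : c (exist _ y H1) = c (exist _ z H2)).
        { destruct (c (exist _ y H1)), (c (exist _ z H2)); simpl in E; subst.
          f_equal. apply proof_irrelevance. }
        apply Hc in E'. congruence. }
      set (Y' := fun y => Y y \/ exists z, Y z /\ y = e' z).
      set (k := fun y => match excluded_middle_informative (Y y) with
        | left _ => f [y]
        | right _ => let z := epsilon (inhabits y) (fun z => Y z /\ y = e' z) in f [z; z] end).
      assert (Hkz : forall y, Y' y -> ~ Y y ->
        let z := epsilon (inhabits y) (fun z => Y z /\ y = e' z) in Y z /\ y = e' z).
      { intros y [Hy|Hy] Hny; try tauto.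
        apply (epsilon_spec (inhabits y) (fun z => Y z /\ y = e' z)); auto. }
      assert (Hk1 : forall y, Y' y -> Y (k y)).
      { intros y Hy. unfold k. destruct (excluded_middle_informative (Y y)); auto.
        destruct (Hkz y Hy n) as [H _]. apply HY, Hpair, H. }
      assert (Hk2 : forall y z, Y' y -> Y' z -> k y = k z -> y = z).
      { intros y z Hy Hz. unfold k.
        destruct (excluded_middle_informative (Y y)) as [H1|H1],
          (excluded_middle_informative (Y z)) as [H2|H2]; intros E;
          try (destruct (Hkz y Hy H1) as [A1 B1]); try (destruct (Hkz z Hz H2) as [A2 B2]);
          apply Hf in E; auto; try discriminate.
        - congruence.
        - injection E as E _. rewrite B1, B2. f_equal. exact E. }
      set (f' := fun l => match excluded_middle_informative (all Y l) with
        | left _ => f l | right _ => e' (f (map k l)) end).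
      assert (Hmk : forall l, all Y' l -> all Y (map k l)).
      { intros l Hl y Hy. apply in_map_iff in Hy. destruct Hy as [x [<- Hx]]. auto. }
      assert (Hok' : ok (Y', f')).
      { split; [|split]; simpl.
        - intros n; left; auto.
        - intros l Hl. unfold f'. destruct (excluded_middle_informative (all Y l)).
          + left; auto.
          + right. exists (f (map k l)). split; auto.
        - intros l m Hl Hm. unfold f'.
          destruct (excluded_middle_informative (all Y l)) as [H1|H1],
            (excluded_middle_informative (all Y m)) as [H2|H2]; intros E; auto.
          + exfalso. apply (He1 (f (map k m))); auto. rewrite <- E. auto.
          + exfalso. apply (He1 (f (map k l))); auto. rewrite E. auto.
          + apply He2 in E; auto. apply Hf in E; auto.
            clear H1 H2. revert m Hm E. induction l as [|a l IH]; intros [|b m] Hm E;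
              try discriminate; auto.
            injection E as E1 E2. f_equal.
            * apply Hk2; auto; [apply Hl | apply Hm]; left; auto.
            * apply IH; auto; intros y Hy; [apply Hl | apply Hm]; right; auto. }
      destruct (Hmax (exist _ _ Hok')) as [Hm _]; simpl.
      { split. { intros y Hy; left; auto. }
        intros l Hl. unfold f'. destruct (excluded_middle_informative (all Y l)); tauto. }
      apply (He1 (e 0%nat)); auto. apply Hm. right. exists (e 0%nat); auto.
Qed.

(** * The continuum and the tree of finite sequences *)

(* Koenig's diagonal argument: if no class contained a copy of [nat -> nat], then each [n] would
   have a value missed by the [n]-th coordinates of the class [n]. *)
Lemma continuum_pigeonhole (T : Type) (C : nat -> T -> Prop) :
  embeds (nat -> nat -> nat) T -> (forall t, exists n, C n t) ->
  exists n (g : (nat -> nat) -> T), Injective g /\ forall x, C n (g x).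
Proof.
  intros [f Hf] HC. apply NNPP. intros Hno.
  assert (H : forall n, exists y : nat -> nat, forall w, C n (f w) -> w n <> y).
  { intros n. apply NNPP. intros H. apply Hno. exists n.
    assert (H' : forall y, exists w, C n (f w) /\ w n = y).
    { intros y. apply NNPP. intros H'. apply H. exists y. intros w H1 H2. eauto. }
    apply choice in H'. destruct H' as [g Hg]. exists (fun y => f (g y)). split.
    - intros y y' E. apply Hf in E.
      rewrite <- (proj2 (Hg y)), <- (proj2 (Hg y')), E. reflexivity.
    - intros y; apply Hg. }
  apply choice in H. destruct H as [w Hw].
  destruct (HC (f w)) as [n Hn]. exact (Hw n w Hn eq_refl).
Qed.

(** With ratio 1/3 the terms after the n-th add up to at most half of (1/3)^n, so a first differing
    digit is never compensated. *)
Fixpoint ternary_sum (b : nat -> bool) (n : nat) : R :=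
  match n with
  | O => 0
  | S m => ternary_sum b m + (if b m then (/ 3) ^ m else 0)
  end.

Lemma ternary_sum_growing b m n : (m <= n)%nat -> ternary_sum b m <= ternary_sum b n.
Proof.
  induction 1 as [|n _ IH]; simpl; [lra|].
  assert (0 < (/ 3) ^ n) by (apply pow_lt; lra). destruct (b n); lra.
Qed.

Lemma ternary_sum_tail b m n : (m <= n)%nat ->
  ternary_sum b n <= ternary_sum b m + 3 / 2 * ((/ 3) ^ m - (/ 3) ^ n).
Proof.
  induction 1 as [|n _ IH]; simpl; [lra|].
  assert (0 < (/ 3) ^ n) by (apply pow_lt; lra). destruct (b n); lra.
Qed.

Lemma embeds_cantor_R : embeds (nat -> bool) R.
Proof.
  assert (H : forall b, exists r, is_lub (fun s => exists n, s = ternary_sum b n) r).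
  { intros b. destruct (completeness (fun s => exists n, s = ternary_sum b n)) as [r Hr].
    - exists (3 / 2). intros s [n ->]. pose proof (ternary_sum_tail b 0 n ltac:(lia)) as H.
      simpl in H. assert (0 < (/ 3) ^ n) by (apply pow_lt; lra). lra.
    - exists 0, 0%nat; reflexivity.
    - eauto. }
  apply choice in H. destruct H as [r Hr]. exists r.
  assert (Hge : forall b n, ternary_sum b n <= r b) by (intros b n; apply Hr; eauto).
  assert (Hle : forall b n, r b <= ternary_sum b n + 3 / 2 * (/ 3) ^ n).
  { intros b n. apply Hr. intros s [k ->].
    assert (0 < (/ 3) ^ n) by (apply pow_lt; lra).
    destruct (Nat.le_ge_cases n k) as [H'|H'].
    - pose proof (ternary_sum_tail b n k H').
      assert (0 < (/ 3) ^ k) by (apply pow_lt; lra). lra.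
    - pose proof (ternary_sum_growing b k n H'). lra. }
  assert (Hext : forall b c n, (forall k, (k < n)%nat -> b k = c k) ->
    ternary_sum b n = ternary_sum c n).
  { intros b c n. induction n as [|n IH]; intros Hk; simpl; auto.
    rewrite IH, Hk; auto. }
  intros b c E. apply functional_extensionality. intros n.
  induction n as [n IH] using (well_founded_induction Nat.lt_wf_0).
  pose proof (Hge b (S n)) as B1. pose proof (Hle b (S n)) as B2.
  pose proof (Hge c (S n)) as C1. pose proof (Hle c (S n)) as C2.
  pose proof (Hext b c n IH) as Ex. simpl in *.
  assert (0 < (/ 3) ^ n) by (apply pow_lt; lra).
  destruct (b n), (c n); auto; exfalso; lra.
Qed.

(** A double sequence is coded by the characteristic function of the codes of its triples
    [[i; j; w i j]], hence by a real. *)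
Lemma embeds_baire_R : embeds (nat -> nat -> nat) R.
Proof.
  apply embeds_trans with (nat -> bool); [|apply embeds_cantor_R].
  exists (fun w m => match choice.CodeSeq.decode m with
    | [i; j; k] => Nat.eqb (w i j) k | _ => false end).
  intros w w' E. apply functional_extensionality; intros i.
  apply functional_extensionality; intros j.
  apply (f_equal (fun h => h (choice.CodeSeq.code [i; j; w i j]))) in E.
  rewrite choice.CodeSeq.codeK, Nat.eqb_refl in E.
  symmetry. apply Nat.eqb_eq. auto.
Qed.

Definition liminf_eq (n : nat) (x : nat -> nat) : Prop :=
  (exists N, forall i, (N <= i)%nat -> (n <= x i)%nat) /\
  (forall N, exists i, (N <= i)%nat /\ x i = n).

Lemma liminf_eq_unique n m x : liminf_eq n x -> liminf_eq m x -> n = m.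
Proof.
  intros [[N H1] H2] [[M H3] H4].
  destruct (H2 M) as [i [Hi Ei]]. destruct (H4 N) as [j [Hj Ej]].
  specialize (H3 i Hi). specialize (H1 j Hj). lia.
Qed.

Definition prolongs (x : nat -> nat) (p : list nat) : Prop :=
  forall i, (i < length p)%nat -> x i = nth i p 0%nat.

(** The tree of the closed set on which [liminf_somewhere_dense] works. The relation weakens as [n]
    decreases, which allows the values of [n] to be treated one after another. *)
Definition extends_above (n : nat) (p q : list nat) : Prop :=
  exists r, q = p ++ r /\ Forall (fun a => (n <= a)%nat) r.

Lemma extends_above_refl n p : extends_above n p p.
Proof. exists []. rewrite app_nil_r; auto. Qed.

Lemma extends_above_trans n p q r :
  extends_above n p q -> extends_above n q r -> extends_above n p r.
Proof.
  intros [a [-> Ha]] [b [-> Hb]]. exists (a ++ b). rewrite app_assoc. split; auto.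
  apply Forall_app; auto.
Qed.

Lemma extends_above_weaken n m p q :
  (n <= m)%nat -> extends_above m p q -> extends_above n p q.
Proof.
  intros H [a [-> Ha]]. exists a. split; auto. eapply Forall_impl; [|exact Ha].
  simpl; intros; lia.
Qed.

(* Baire category in the closed set of the [x] that prolong [p] with entries [>= n] afterwards,
   where [liminf x = n] is generic. *)
Lemma liminf_somewhere_dense (n : nat) (k : (nat -> nat) -> nat) (p : list nat) :
  exists q M, extends_above n p q /\ forall q', extends_above n q q' ->
    exists x, liminf_eq n x /\ prolongs x q' /\ (k x <= M)%nat.
Proof.
  apply NNPP. intros Hno.
  (* If no node works, every admissible node has a prolongation below which [k] exceeds [M] at each
     point of liminf [n]. *)
  assert (HG : forall Mq : nat * list nat, exists q', extends_above n p (snd Mq) ->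
    extends_above n (snd Mq) q' /\
    forall x, liminf_eq n x -> prolongs x q' -> (fst Mq < k x)%nat).
  { intros [M q]. simpl. destruct (classic (extends_above n p q)) as [Hq|Hq].
    2:{ exists q; tauto. }
    apply NNPP. intros H. apply Hno. exists q, M. split; auto. intros q' Hq'.
    apply NNPP. intros H'. apply H. exists q'. intros _. split; auto.
    intros x Hx1 Hx2. destruct (Nat.le_gt_cases (k x) M); auto. exfalso; eauto. }
  apply choice in HG. destruct HG as [G HG].
  (* Stage [i] pushes [k] above [i]; appending [n] first makes [n] recur in the limit and the
     lengths grow. *)
  set (Q := fix Q j := match j with O => p | S i => G (i, Q i ++ [n]) end).
  assert (Hone : forall q, extends_above n q (q ++ [n])).
  { intros q. exists [n]. auto. }
  assert (HQp : forall j, extends_above n p (Q j)).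
  { induction j; simpl; [apply extends_above_refl|].
    assert (H : extends_above n p (Q j ++ [n])) by (eapply extends_above_trans; eauto).
    eapply extends_above_trans; [exact H|]. exact (proj1 (HG (j, Q j ++ [n]) H)). }
  assert (HQS : forall j, extends_above n (Q j ++ [n]) (Q (S j))).
  { intros j. refine (proj1 (HG (j, Q j ++ [n]) _)). exact (extends_above_trans _ _ _ _ (HQp j) (Hone (Q j))). }
  assert (HQle : forall i j, (i <= j)%nat -> extends_above n (Q i) (Q j)).
  { induction 1; [apply extends_above_refl|].
    refine (extends_above_trans _ _ _ _ IHle (extends_above_trans _ _ _ _ (Hone _) (HQS m))). }
  assert (Hlen : forall j, (j <= length (Q j))%nat).
  { induction j; [lia|]. destruct (HQS j) as [r [E _]]. rewrite E, !length_app. simpl. lia. }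
  assert (Hnth : forall q q' i, extends_above n q q' -> (i < length q)%nat ->
    nth i q' 0%nat = nth i q 0%nat).
  { intros q q' i [r [-> _]] Hi. apply app_nth1; auto. }
  set (x := fun i => nth i (Q (S i)) 0%nat).
  assert (Hx : forall j, prolongs x (Q j)).
  { intros j i Hi. unfold x. destruct (Nat.le_ge_cases (S i) j) as [H|H].
    - symmetry. apply Hnth; [auto|]. exact (Hlen (S i)).
    - apply Hnth; auto. }
  assert (HE : liminf_eq n x).
  { split.
    - exists (length p). intros i Hi. unfold x. destruct (HQp (S i)) as [r [E Hr]].
      pose proof (Hlen (S i)) as L. rewrite E in L |- *. rewrite length_app in L.
      rewrite app_nth2 by lia. rewrite Forall_forall in Hr. apply Hr. apply nth_In. lia.
    - intros N. exists (length (Q N)). split; auto.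
      rewrite (Hx (S N)); destruct (HQS N) as [r [E _]]; rewrite E.
      + rewrite app_nth1 by (rewrite length_app; simpl; lia).
        rewrite app_nth2 by lia. rewrite Nat.sub_diag. reflexivity.
      + rewrite !length_app. simpl. lia. }
  (* The limit prolongs [Q (S (k x))], where [k] was forced above [k x]. *)
  pose proof (extends_above_trans _ _ _ _ (HQp (k x)) (Hone _)) as H.
  destruct (HG (k x, Q (k x) ++ [n]) H) as [_ Hk].
  specialize (Hk x HE (Hx (S (k x)))). simpl in Hk. lia.
Qed.

(** Induction on [m]: the node found for the new value [m] prolongs the old one by entries at least
    [m], hence inside the tree of each smaller [n], so the earlier conclusions persist below it. *)
Lemma liminf_common_prefix (k : nat -> (nat -> nat) -> nat) (m : nat) :
  exists p, forall n, (n < m)%nat ->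
    exists x, liminf_eq n x /\ prolongs x p /\ (k n x <= length p)%nat.
Proof.
  assert (H : exists p M, forall n, (n < m)%nat -> forall q, extends_above n p q ->
    exists x, liminf_eq n x /\ prolongs x q /\ (k n x <= M)%nat).
  { induction m as [|m [p [M IH]]].
    - exists [], 0%nat. intros; lia.
    - destruct (liminf_somewhere_dense m (k m) p) as [q [M' [Hpq Hq]]].
      exists q, (Nat.max M M'). intros n Hn q' Hq'.
      destruct (Nat.eq_dec n m) as [->|Hne].
      + destruct (Hq q' Hq') as [x [H1 [H2 H3]]]. exists x. repeat split; auto; try apply H1. lia.
      + destruct (IH n ltac:(lia) q') as [x [H1 [H2 H3]]].
        { eapply extends_above_trans; [|exact Hq'].
          eapply extends_above_weaken; [|exact Hpq]. lia. }
        exists x. repeat split; auto; try apply H1. lia. }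
  (* Padding with [M] entries [m] brings the length up to the bound [M] and stays in the tree of
     every [n < m]. *)
  destruct H as [p [M H]]. exists (p ++ repeat m M). intros n Hn.
  destruct (H n Hn (p ++ repeat m M)) as [x [H1 [H2 H3]]].
  { exists (repeat m M). split; auto. apply Forall_forall. intros a Ha.
    apply repeat_spec in Ha. lia. }
  exists x. rewrite length_app, repeat_length. repeat split; auto; try apply H1. lia.
Qed.

(** * Bounded inverse theorem *)

Definition bsub {Z : Banach} (x y : Z) : Z := badd x (bopp y).

Section BanachTheory.
Variable Z : Banach.
Implicit Types x y z w : Z.

Lemma badd_0_l x : badd bzero x = x.
Proof. rewrite badd_comm. apply badd_0. Qed.

Lemma badd_cancel x y z : badd x y = badd x z -> y = z.
Proof.
  intros H. rewrite <- (badd_0_l y), <- (badd_0_l z), <- (badd_opp _ x), (badd_comm _ x).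
  rewrite <- !badd_assoc, H. reflexivity.
Qed.

Lemma bscal_0 x : bscal 0 x = bzero.
Proof.
  apply (badd_cancel (bscal 0 x)). rewrite <- bscal_addl, badd_0. f_equal. lra.
Qed.

Lemma bopp_scal x : bopp x = bscal (-1) x.
Proof.
  apply (badd_cancel x). rewrite badd_opp. rewrite <- (bscal_1 _ x) at 1.
  rewrite <- bscal_addl. replace (1 + -1) with 0 by lra. rewrite bscal_0. reflexivity.
Qed.

Lemma badd_swap x y z w : badd (badd x y) (badd z w) = badd (badd x z) (badd y w).
Proof.
  rewrite <- !badd_assoc. f_equal. rewrite !badd_assoc. f_equal. apply badd_comm.
Qed.

Lemma bsub_add x y z w : bsub (badd x y) (badd z w) = badd (bsub x z) (bsub y w).
Proof. unfold bsub. rewrite !bopp_scal, bscal_addr. apply badd_swap. Qed.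

Lemma bsub_0 x : bsub x bzero = x.
Proof. rewrite <- (badd_0 _ (bsub x bzero)). unfold bsub.
  rewrite <- badd_assoc, (badd_comm _ (bopp bzero)), badd_opp, badd_0. reflexivity. Qed.

Lemma bsub_diag x : bsub x x = bzero.
Proof. apply badd_opp. Qed.

Lemma bsub_telescope x y z : badd (bsub x y) (bsub y z) = bsub x z.
Proof.
  unfold bsub. rewrite <- badd_assoc. f_equal. rewrite badd_assoc.
  rewrite (badd_comm _ (bopp y)), badd_opp. apply badd_0_l.
Qed.

Lemma bsub_scal a x y : bscal a (bsub x y) = bsub (bscal a x) (bscal a y).
Proof.
  unfold bsub. rewrite bscal_addr, !bopp_scal, !bscal_mul. do 2 f_equal. lra.
Qed.

Lemma bsub_eq0 x y : bsub x y = bzero -> x = y.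
Proof.
  intros H. rewrite <- (bsub_0 x), <- (bsub_telescope x y bzero), H, bsub_0. apply badd_0_l.
Qed.

Lemma bnorm_0 : bnorm (bzero : Z) = 0.
Proof. rewrite <- (bscal_0 bzero), bnorm_scal, Rabs_R0. lra. Qed.

Lemma bnorm_sub_sym x y : bnorm (bsub x y) = bnorm (bsub y x).
Proof.
  replace (bsub x y) with (bscal (-1) (bsub y x)).
  - rewrite bnorm_scal, Rabs_left by lra. lra.
  - rewrite bsub_scal. unfold bsub. rewrite !bopp_scal, bscal_mul.
    replace (-1 * -1) with 1 by lra. rewrite bscal_1. apply badd_comm.
Qed.

Lemma bnorm_sub_triangle x y z : bnorm (bsub x z) <= bnorm (bsub x y) + bnorm (bsub y z).
Proof. rewrite <- (bsub_telescope x y z). apply bnorm_triangle. Qed.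

Lemma bnorm_ge0 x : 0 <= bnorm x.
Proof.
  pose proof (bnorm_sub_triangle x bzero x) as H.
  rewrite bsub_diag, bnorm_0, (bnorm_sub_sym bzero x), bsub_0 in H. lra.
Qed.

Lemma bnorm_sub_le x y : bnorm (bsub x y) <= bnorm x + bnorm y.
Proof.
  pose proof (bnorm_sub_triangle x bzero y) as H.
  rewrite (bnorm_sub_sym bzero y), !bsub_0 in H. lra.
Qed.

Definition bcvg (u : nat -> Z) (l : Z) : Prop :=
  forall eps, 0 < eps -> exists N, forall n, (N <= n)%nat -> bnorm (bsub (u n) l) < eps.

Lemma geometric_cvg (u : nat -> Z) (c : R) : 0 <= c ->
  (forall m n, (m <= n)%nat -> bnorm (bsub (u n) (u m)) <= c * (/ 2) ^ m) ->
  exists l, bcvg u l /\ forall m, bnorm (bsub l (u m)) <= c * (/ 2) ^ m.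
Proof.
  intros Hc H.
  destruct (bcomplete Z u) as [l Hl].
  - intros eps He. destruct (pow_lt_1_zero (/ 2)) with (y := eps / (c + 1)) as [N HN].
    { rewrite Rabs_right; lra. } { apply Rdiv_lt_0_compat; lra. }
    exists N. intros m n Hm Hn.
    assert (Hb : forall k, (N <= k)%nat -> c * (/ 2) ^ k < eps).
    { intros k Hk. specialize (HN k Hk). assert (0 < (/ 2) ^ k) by (apply pow_lt; lra).
      rewrite Rabs_right in HN by lra.
      apply (Rmult_lt_compat_l (c + 1)) in HN; [|lra].
      replace ((c + 1) * (eps / (c + 1))) with eps in HN by (field; lra). lra. }
    change (bnorm (bsub (u m) (u n)) < eps).
    destruct (Nat.le_ge_cases m n) as [L|L].
    + rewrite bnorm_sub_sym. eapply Rle_lt_trans; [apply H; auto|auto].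
    + eapply Rle_lt_trans; [apply H; auto|auto].
  - exists l. split; [exact Hl|]. intros m. apply le_epsilon.
    intros eps He. destruct (Hl eps He) as [N HN].
    specialize (HN (Nat.max N m) ltac:(lia)). specialize (H m (Nat.max N m) ltac:(lia)).
    fold (bsub (u (Nat.max N m)) l) in HN.
    pose proof (bnorm_sub_triangle l (u (Nat.max N m)) (u m)) as T.
    rewrite (bnorm_sub_sym l (u (Nat.max N m))) in T. lra.
Qed.

End BanachTheory.

Definition blinear {X Y : Banach} (T : X -> Y) : Prop :=
  forall a x y, T (badd (bscal a x) y) = badd (bscal a (T x)) (T y).

Section BoundedInverse.
Variables (X Y : Banach) (T : X -> Y).
Hypothesis Tlin : blinear T.

Lemma blinear_0 : T bzero = bzero.
Proof.
  apply (badd_cancel _ (T bzero)). rewrite badd_0.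
  rewrite <- (bscal_1 _ (T bzero)) at 1. rewrite <- Tlin. rewrite bscal_1, badd_0. reflexivity.
Qed.

Lemma blinear_scal a x : T (bscal a x) = bscal a (T x).
Proof. rewrite <- (badd_0 _ (bscal a x)), Tlin, blinear_0, badd_0. reflexivity. Qed.

Lemma blinear_add x y : T (badd x y) = badd (T x) (T y).
Proof. rewrite <- (bscal_1 _ x), Tlin, !bscal_1. reflexivity. Qed.

Lemma blinear_sub x y : T (bsub x y) = bsub (T x) (T y).
Proof. unfold bsub. rewrite blinear_add, !bopp_scal, blinear_scal. reflexivity. Qed.

Hypothesis Tsurj : forall y, exists x, T x = y.

(** Baire category with nested balls: if the image of no ball were somewhere dense, balls could be
    shrunk to a point that differs, for every [n], from all [T x] with [x] of norm at most [n],
    against surjectivity. *)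
Lemma image_ball_somewhere_dense : exists (n : nat) (y0 : Y) (r : R), 0 < r /\
  forall y, bnorm (bsub y y0) < r -> forall eta, 0 < eta ->
    exists x, bnorm x <= INR n /\ bnorm (bsub y (T x)) < eta.
Proof.
  apply NNPP. intros Hno.
  assert (HG : forall p : nat * Y * R, exists q : Y * R, 0 < snd p ->
    bnorm (bsub (fst q) (snd (fst p))) < snd p /\ 0 < snd q /\
    forall x, bnorm x <= INR (fst (fst p)) -> snd q <= bnorm (bsub (fst q) (T x))).
  { intros [[n y0] r]. simpl. destruct (classic (0 < r)) as [Hr|Hr].
    2:{ exists (y0, r). tauto. }
    apply NNPP. intros H. apply Hno. exists n, y0, r. split; auto. intros y Hy eta Heta.
    apply NNPP. intros H'. apply H. exists (y, eta). intros _. split; [|split]; auto.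
    intros x Hx. simpl. apply Rnot_lt_le. intros H1. apply H'. eauto. }
  apply choice in HG. destruct HG as [G HG].
  (* Each ball lies in the preceding one, since the centre moves by less than half the radius and
     the radius is at least halved. Halving [snd q] as well keeps the limit off the image excluded
     at that stage. *)
  set (Q := fix Q n : Y * R := match n with
    | O => (bzero, 1)
    | S m => let q := G (m, fst (Q m), snd (Q m) / 2) in
             (fst q, Rmin (snd q / 2) (snd (Q m) / 2)) end).
  assert (Hr : forall n, 0 < snd (Q n) <= (/ 2) ^ n).
  { induction n as [|n IH]; simpl; [lra|].
    destruct (HG (n, fst (Q n), snd (Q n) / 2)) as [_ [H _]]; simpl; [lra|].
    split.
    - apply Rmin_pos; lra.
    - eapply Rle_trans; [apply Rmin_r|]. lra. }
  assert (Hstep : forall m n, (m <= n)%nat ->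
    bnorm (bsub (fst (Q n)) (fst (Q m))) <= snd (Q m) - snd (Q n)).
  { induction 1 as [|n Hmn IH].
    - rewrite bsub_diag, bnorm_0. lra.
    - destruct (HG (n, fst (Q n), snd (Q n) / 2)) as [H _]; simpl; [pose proof (Hr n); lra|].
      pose proof (bnorm_sub_triangle _ (fst (Q (S n))) (fst (Q n)) (fst (Q m))) as Ht.
      simpl in *.
      pose proof (Rmin_r (snd (G (n, fst (Q n), snd (Q n) / 2)) / 2) (snd (Q n) / 2)). lra. }
  destruct (geometric_cvg Y (fun n => fst (Q n)) 1) as [y [Hy _]]; [lra| |].
  { intros m n Hmn. specialize (Hstep m n Hmn). pose proof (Hr m). pose proof (Hr n). lra. }
  destruct (Tsurj y) as [x <-].
  destruct (INR_unbounded (bnorm x)) as [n Hn].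
  destruct (HG (n, fst (Q n), snd (Q n) / 2)) as [_ [H1 H2]]; simpl; [pose proof (Hr n); lra|].
  specialize (H2 x ltac:(simpl; lra)). simpl in H1, H2.
  assert (Hlim : bnorm (bsub (fst (Q (S n))) (T x)) <= snd (Q (S n))).
  { apply le_epsilon. intros eps He. destruct (Hy eps He) as [N HN].
    specialize (HN (Nat.max N (S n)) ltac:(lia)). simpl in HN.
    specialize (Hstep (S n) (Nat.max N (S n)) ltac:(lia)).
    pose proof (bnorm_sub_triangle _ (fst (Q (S n))) (fst (Q (Nat.max N (S n)))) (T x)) as Ht.
    rewrite (bnorm_sub_sym _ (fst (Q (S n))) (fst (Q (Nat.max N (S n))))) in Ht.
    pose proof (Hr (Nat.max N (S n))). lra. }
  simpl in Hlim.
  pose proof (Rmin_l (snd (G (n, fst (Q n), snd (Q n) / 2)) / 2) (snd (Q n) / 2)). lra.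
Qed.

(** Approximate preimages of [s y + y0] and of [y0] are subtracted and divided by [s], where [s]
    makes [s y] of length r/2. *)
Lemma approximate_preimage : exists c, 0 < c /\ forall y eta, 0 < eta ->
  exists x, bnorm x <= c * bnorm y /\ bnorm (bsub y (T x)) < eta.
Proof.
  destruct image_ball_somewhere_dense as [n [y0 [r [Hr H]]]].
  pose proof (pos_INR n) as Hn.
  (* Two vectors of norm at most n, divided by s = r / (2 |y|), give 4 n |y| / r; the summand 1
     keeps the constant positive when n = 0. *)
  exists (4 * INR n / r + 1). split.
  { assert (0 <= 4 * INR n / r) by (apply Rle_mult_inv_pos; lra). lra. }
  intros y eta He. destruct (Req_dec (bnorm y) 0) as [E|E].
  { exists bzero. rewrite blinear_0, bsub_0, bnorm_0, E. lra. }
  pose proof (bnorm_ge0 _ y) as Hy0. assert (Hy : 0 < bnorm y) by lra.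
  set (s := r / (2 * bnorm y)). assert (Hs : 0 < s) by (apply Rdiv_lt_0_compat; lra).
  assert (Hs' : 0 < eta * s / 2).
  { apply Rdiv_lt_0_compat; [|lra]. apply Rmult_lt_0_compat; lra. }
  destruct (H (badd (bscal s y) y0)) with (eta := eta * s / 2) as [x1 [A1 B1]]; auto.
  { replace (bsub (badd (bscal s y) y0) y0) with (bscal s y).
    - rewrite bnorm_scal, Rabs_right by lra. unfold s.
      replace (r / (2 * bnorm y) * bnorm y) with (r / 2) by (field; lra). lra.
    - unfold bsub. rewrite <- badd_assoc, badd_opp, badd_0. reflexivity. }
  destruct (H y0) with (eta := eta * s / 2) as [x2 [A2 B2]]; auto.
  { rewrite bsub_diag, bnorm_0. lra. }
  assert (Hi : 0 < / s) by (apply Rinv_0_lt_compat; lra).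
  exists (bscal (/ s) (bsub x1 x2)). split.
  - rewrite bnorm_scal, Rabs_right by lra.
    pose proof (bnorm_sub_le _ x1 x2).
    apply Rle_trans with (/ s * (2 * INR n)).
    + apply Rmult_le_compat_l; lra.
    + unfold s. replace (/ (r / (2 * bnorm y)) * (2 * INR n)) with (4 * INR n / r * bnorm y)
        by (field; lra). lra.
  - rewrite blinear_scal, blinear_sub.
    replace (bsub y (bscal (/ s) (bsub (T x1) (T x2)))) with
      (bscal (/ s) (bsub (bsub (badd (bscal s y) y0) (T x1)) (bsub y0 (T x2)))).
    + rewrite bnorm_scal, Rabs_right by lra.
      pose proof (bnorm_sub_le _ (bsub (badd (bscal s y) y0) (T x1)) (bsub y0 (T x2))).
      replace eta with (/ s * (eta * s / 2 + eta * s / 2)) by (field; lra).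
      apply Rmult_lt_compat_l; lra.
    + replace (bsub y (bscal (/ s) (bsub (T x1) (T x2)))) with
        (bscal (/ s) (bsub (bscal s y) (bsub (T x1) (T x2)))).
      2:{ rewrite bsub_scal, bscal_mul. replace (/ s * s) with 1 by (field; lra).
          rewrite bscal_1. reflexivity. }
      f_equal. unfold bsub. rewrite !bopp_scal, !bscal_addr, !bscal_mul.
      replace (-1 * -1) with 1 by lra. rewrite !bscal_1.
      rewrite <- !badd_assoc. f_equal.
      rewrite (badd_assoc _ y0), (badd_comm _ y0), <- badd_assoc. f_equal.
      rewrite badd_assoc, <- bopp_scal, badd_opp, badd_0_l. reflexivity.
Qed.

Hypothesis Tbdd : exists M, forall x, bnorm (T x) <= M * bnorm x.
Hypothesis Tinj : forall x, T x = bzero -> x = bzero.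

(** Successive approximation: each residual gets an approximate preimage that halves its bound, so
    the corrections sum to an exact preimage of norm at most [2 * c * bnorm (T x)], which is [x] by
    injectivity. *)
Lemma bounded_inverse : exists C, forall x, bnorm x <= C * bnorm (T x).
Proof.
  destruct approximate_preimage as [c [Hc H]]. exists (2 * c). intros x.
  destruct (Req_dec (bnorm (T x)) 0) as [E|E].
  { rewrite (Tinj x), bnorm_0.
    - rewrite blinear_0, bnorm_0. lra.
    - apply bnorm_eq0; auto. }
  assert (Hy : 0 < bnorm (T x)) by (pose proof (bnorm_ge0 _ (T x)); lra).
  set (y := T x) in *.
  assert (HF : forall p : Y * R, exists x, 0 < snd p ->
    bnorm x <= c * bnorm (fst p) /\ bnorm (bsub (fst p) (T x)) < snd p).
  { intros [z eta]. simpl. destruct (classic (0 < eta)) as [He|He].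
    - destruct (H z eta He) as [w Hw]. exists w; auto.
    - exists bzero. tauto. }
  apply choice in HF. destruct HF as [F HF].
  set (h := fun k => bnorm y * (/ 2) ^ k).
  assert (Hh : forall k, 0 < h k).
  { intros k. apply Rmult_lt_0_compat; auto. apply pow_lt; lra. }
  set (s := fix s k : X := match k with
    | O => bzero | S j => badd (F (bsub y (T (s j)), h (S j))) (s j) end).
  assert (Hres : forall k, bnorm (bsub y (T (s k))) <= h k).
  { intros [|k].
    - unfold h; simpl. rewrite blinear_0, bsub_0. lra.
    - destruct (HF (bsub y (T (s k)), h (S k)) (Hh _)) as [_ H2]. simpl fst in H2. simpl snd in H2.
      simpl s. rewrite blinear_add.
      replace (bsub y (badd (T (F (bsub y (T (s k)), h (S k)))) (T (s k)))) with
        (bsub (bsub y (T (s k))) (T (F (bsub y (T (s k)), h (S k))))). 1: lra.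
      unfold bsub at 1 2 4. rewrite !bopp_scal, bscal_addr, <- badd_assoc. f_equal.
      apply badd_comm. }
  destruct (geometric_cvg X s (2 * c * bnorm y)) as [x' [Hx1 Hx2]].
  { apply Rmult_le_pos; lra. }
  { assert (Hs : forall m n, (m <= n)%nat ->
      bnorm (bsub (s n) (s m)) <= 2 * c * bnorm y * ((/ 2) ^ m - (/ 2) ^ n)).
    { induction 1 as [|n Hmn IH].
      - rewrite bsub_diag, bnorm_0. lra.
      - destruct (HF (bsub y (T (s n)), h (S n)) (Hh _)) as [H1 _]. simpl fst in H1.
        simpl s. rewrite <- (bsub_0 _ (s m)), <- (badd_0_l _ (bsub (s m) bzero)), bsub_0.
        rewrite bsub_add, bsub_0.
        eapply Rle_trans; [apply bnorm_triangle|].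
        apply Rle_trans with (c * h n + 2 * c * bnorm y * ((/ 2) ^ m - (/ 2) ^ n)).
        + apply Rplus_le_compat; auto. eapply Rle_trans; [exact H1|].
          apply Rmult_le_compat_l; [lra|auto].
        + unfold h. simpl. lra. }
    intros m n Hmn. eapply Rle_trans; [apply Hs; auto|].
    apply Rmult_le_compat_l; [apply Rmult_le_pos; lra|].
    assert (0 < (/ 2) ^ n) by (apply pow_lt; lra). lra. }
  assert (E' : x = x').
  { apply bsub_eq0, Tinj. rewrite blinear_sub. fold y. apply bnorm_eq0.
    apply Rle_antisym; [|apply bnorm_ge0]. destruct Tbdd as [M HM].
    assert (HM' : 0 <= Rmax M 0) by apply Rmax_r.
    apply le_epsilon. intros eps He.
    destruct (Hx1 (eps / 2 / (Rmax M 0 + 1))) as [N HN].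
    { apply Rdiv_lt_0_compat; lra. }
    destruct (pow_lt_1_zero (/ 2)) with (y := eps / 2 / bnorm y) as [N' HN'].
    { rewrite Rabs_right; lra. } { apply Rdiv_lt_0_compat; lra. }
    set (k := Nat.max N N'). specialize (HN k ltac:(lia)). specialize (HN' k ltac:(lia)).
    assert (Hk : 0 < (/ 2) ^ k) by (apply pow_lt; lra). rewrite Rabs_right in HN' by lra.
    pose proof (bnorm_sub_triangle _ y (T (s k)) (T x')) as Ht.
    rewrite <- blinear_sub in Ht. specialize (Hres k). unfold h in Hres.
    apply (Rmult_lt_compat_l (bnorm y)) in HN'; auto.
    replace (bnorm y * (eps / 2 / bnorm y)) with (eps / 2) in HN' by (field; lra).
    specialize (HM (bsub (s k) x')).
    assert (M * bnorm (bsub (s k) x') <= (Rmax M 0 + 1) * bnorm (bsub (s k) x')).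
    { apply Rmult_le_compat_r; [apply bnorm_ge0|]. pose proof (Rmax_l M 0). lra. }
    apply (Rmult_lt_compat_l (Rmax M 0 + 1)) in HN; [|lra].
    replace ((Rmax M 0 + 1) * (eps / 2 / (Rmax M 0 + 1))) with (eps / 2) in HN by (field; lra).
    lra. }
  subst x'. specialize (Hx2 0%nat). simpl in Hx2. rewrite bsub_0 in Hx2. lra.
Qed.

End BoundedInverse.

(** * Bounded functions and closed subspaces *)

Definition closed_subspace (Z : Banach) (W : Z -> Prop) : Prop :=
  W bzero /\
  (forall a w1 w2, W w1 -> W w2 -> W (badd (bscal a w1) w2)) /\
  (forall (u : nat -> Z) l, (forall n, W (u n)) -> bcvg Z u l -> W l).

Lemma sig_eq (A : Type) (P : A -> Prop) (x y : {a | P a}) : proj1_sig x = proj1_sig y -> x = y.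
Proof.
  destruct x as [x Hx], y as [y Hy]; simpl; intros ->. f_equal. apply proof_irrelevance.
Qed.

Section SubBanach.
Variables (Z : Banach) (W : Z -> Prop).
Hypothesis HW : closed_subspace Z W.

Lemma sub_add_closed (x y : {z | W z}) : W (badd (proj1_sig x) (proj1_sig y)).
Proof.
  rewrite <- (bscal_1 _ (proj1_sig x)). apply HW; [exact (proj2_sig x) | exact (proj2_sig y)].
Qed.

Lemma sub_scal_closed a (x : {z | W z}) : W (bscal a (proj1_sig x)).
Proof.
  rewrite <- (badd_0 _ (bscal a _)). apply HW; [exact (proj2_sig x) | apply HW].
Qed.

Lemma sub_opp_closed (x : {z | W z}) : W (bopp (proj1_sig x)).
Proof. rewrite bopp_scal. apply sub_scal_closed. Qed.

Definition sub_banach : Banach.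
Proof.
  refine {| bcar := {z | W z};
            bzero := exist _ bzero (proj1 HW);
            badd := fun x y => exist _ _ (sub_add_closed x y);
            bopp := fun x => exist _ _ (sub_opp_closed x);
            bscal := fun a x => exist _ _ (sub_scal_closed a x);
            bnorm := fun x => bnorm (proj1_sig x) |}.
  - intros x y z. apply sig_eq; simpl. apply badd_assoc.
  - intros x y. apply sig_eq; simpl. apply badd_comm.
  - intros x. apply sig_eq; simpl. apply badd_0.
  - intros x. apply sig_eq; simpl. apply badd_opp.
  - intros a x y. apply sig_eq; simpl. apply bscal_addr.
  - intros a b x. apply sig_eq; simpl. apply bscal_addl.
  - intros a b x. apply sig_eq; simpl. apply bscal_mul.
  - intros x. apply sig_eq; simpl. apply bscal_1.
  - intros x H. apply sig_eq; simpl. apply bnorm_eq0; auto.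
  - intros a x. apply bnorm_scal.
  - intros x y. apply bnorm_triangle.
  - intros u Hu. destruct (bcomplete Z (fun n => proj1_sig (u n)) Hu) as [l Hl].
    assert (Wl : W l).
    { apply (proj2 (proj2 HW)) with (fun n => proj1_sig (u n)); auto.
      intros n; apply (proj2_sig (u n)). }
    exists (exist _ l Wl). exact Hl.
Defined.

End SubBanach.

Definition bounded_fun {S : Type} (f : S -> R) : Prop := exists M, forall s, Rabs (f s) <= M.

Section Linf.
Variable S : Type.

(** The value 0 is put in the set so that its supremum exists even when [S] is empty. *)
Definition sup_norm (f : {f : S -> R | bounded_fun f}) : R.
Proof.
  refine (proj1_sig (completeness (fun r => r = 0 \/ exists s, r = Rabs (proj1_sig f s)) _ _)).
  - destruct f as [f [M HM]]. exists (Rmax 0 M). intros r [->|[s ->]].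
    + apply Rmax_l.
    + eapply Rle_trans; [apply HM | apply Rmax_r].
  - exists 0; auto.
Defined.

Lemma sup_norm_lub f :
  is_lub (fun r => r = 0 \/ exists s, r = Rabs (proj1_sig f s)) (sup_norm f).
Proof. unfold sup_norm. apply proj2_sig. Qed.

Lemma sup_norm_le f b : 0 <= b -> (forall s, Rabs (proj1_sig f s) <= b) -> sup_norm f <= b.
Proof. intros Hb H. apply (sup_norm_lub f). intros r [->|[s ->]]; auto. Qed.

Lemma sup_norm_ge f s : Rabs (proj1_sig f s) <= sup_norm f.
Proof. apply (sup_norm_lub f). eauto. Qed.

Lemma sup_norm_ge0 f : 0 <= sup_norm f.
Proof. apply (sup_norm_lub f). auto. Qed.

Lemma bounded_fun_lin a (f g : S -> R) :
  bounded_fun f -> bounded_fun g -> bounded_fun (fun s => a * f s + g s).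
Proof.
  intros [M HM] [N HN]. exists (Rabs a * M + N). intros s.
  eapply Rle_trans; [apply Rabs_triang|]. rewrite Rabs_mult.
  apply Rplus_le_compat; auto. apply Rmult_le_compat_l; auto. apply Rabs_pos.
Qed.

Lemma bounded_fun_const c : bounded_fun (fun _ : S => c).
Proof. exists (Rabs c). intros; lra. Qed.

Lemma bounded_fun_add (f g : {f : S -> R | bounded_fun f}) :
  bounded_fun (fun s => proj1_sig f s + proj1_sig g s).
Proof.
  destruct (bounded_fun_lin 1 _ _ (proj2_sig f) (proj2_sig g)) as [M HM].
  exists M. intros s. rewrite <- (Rmult_1_l (proj1_sig f s)). apply HM.
Qed.

Lemma bounded_fun_scal a (f : {f : S -> R | bounded_fun f}) :
  bounded_fun (fun s => a * proj1_sig f s).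
Proof.
  destruct (bounded_fun_lin a _ _ (proj2_sig f) (bounded_fun_const 0)) as [M HM].
  exists M. intros s. rewrite <- (Rplus_0_r (a * proj1_sig f s)). apply HM.
Qed.

Definition linf : Banach.
Proof.
  refine {| bcar := {f : S -> R | bounded_fun f};
            bzero := exist _ _ (bounded_fun_const 0);
            badd := fun f g => exist _ _ (bounded_fun_add f g);
            bopp := fun f => exist _ _ (bounded_fun_scal (-1) f);
            bscal := fun a f => exist _ _ (bounded_fun_scal a f);
            bnorm := sup_norm |};
    try (intros; apply sig_eq; apply functional_extensionality; intros s; simpl; ring).
  - intros f H. apply sig_eq, functional_extensionality. intros s. simpl.
    pose proof (sup_norm_ge f s) as Hs. pose proof (Rabs_pos (proj1_sig f s)).
    destruct (Req_dec (proj1_sig f s) 0) as [E|E]; auto.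
    apply Rabs_no_R0 in E. lra.
  - intros a f. apply Rle_antisym.
    + apply sup_norm_le.
      * apply Rmult_le_pos; [apply Rabs_pos | apply sup_norm_ge0].
      * intros s. simpl. rewrite Rabs_mult. apply Rmult_le_compat_l; [apply Rabs_pos|].
        apply sup_norm_ge.
    + destruct (Req_dec a 0) as [->|Ha].
      { rewrite Rabs_R0, Rmult_0_l. apply sup_norm_ge0. }
      apply Rabs_pos_lt in Ha.
      apply Rmult_le_reg_l with (/ Rabs a); [apply Rinv_0_lt_compat; auto|].
      rewrite <- Rmult_assoc, Rinv_l, Rmult_1_l by lra.
      apply sup_norm_le.
      * apply Rmult_le_pos; [left; apply Rinv_0_lt_compat; auto | apply sup_norm_ge0].
      * intros s. apply Rmult_le_reg_l with (Rabs a); auto.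
        rewrite <- Rmult_assoc, Rinv_r, Rmult_1_l by lra. rewrite <- Rabs_mult.
        apply (sup_norm_ge (exist _ _ (bounded_fun_scal a f)) s).
  - intros f g. apply sup_norm_le.
    + apply Rplus_le_le_0_compat; apply sup_norm_ge0.
    + intros s. simpl. eapply Rle_trans; [apply Rabs_triang|].
      apply Rplus_le_compat; apply sup_norm_ge.
  - intros u Hu.
    assert (Hpt : forall eps, 0 < eps -> exists N, forall m n, (N <= m)%nat -> (N <= n)%nat ->
      forall s, Rabs (proj1_sig (u m) s - proj1_sig (u n) s) < eps).
    { intros eps He. destruct (Hu eps He) as [N HN]. exists N. intros m n Hm Hn s.
      eapply Rle_lt_trans; [|apply (HN m n Hm Hn)].
      replace (proj1_sig (u m) s - proj1_sig (u n) s)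
        with (proj1_sig (u m) s + -1 * proj1_sig (u n) s) by ring.
      apply (sup_norm_ge (exist _ _ (bounded_fun_add (u m)
        (exist _ _ (bounded_fun_scal (-1) (u n))))) s). }
    assert (Hl : forall s, exists l, Un_cv (fun n => proj1_sig (u n) s) l).
    { intros s. destruct (R_complete (fun n => proj1_sig (u n) s)) as [l Hl]; [|eauto].
      intros eps He. destruct (Hpt eps He) as [N HN]. exists N. intros n m Hn Hm.
      apply HN; auto. }
    apply choice in Hl. destruct Hl as [l Hl].
    assert (Hlim : forall eps, 0 < eps -> exists N, forall n, (N <= n)%nat ->
      forall s, Rabs (proj1_sig (u n) s - l s) <= eps).
    { intros eps He. destruct (Hpt eps He) as [N HN]. exists N. intros n Hn s.
      apply le_epsilon. intros e He'. destruct (Hl s e He') as [N' HN'].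
      specialize (HN' (Nat.max N N') ltac:(lia)). specialize (HN n (Nat.max N N') Hn ltac:(lia) s).
      unfold Rdist in HN'.
      replace (proj1_sig (u n) s - l s) with
        ((proj1_sig (u n) s - proj1_sig (u (Nat.max N N')) s)
         + (proj1_sig (u (Nat.max N N')) s - l s)) by ring.
      eapply Rle_trans; [apply Rabs_triang|]. lra. }
    assert (Hb : bounded_fun l).
    { destruct (Hlim 1 Rlt_0_1) as [N HN]. destruct (proj2_sig (u N)) as [M HM].
      exists (M + 1). intros s. specialize (HN N (le_n _) s). specialize (HM s).
      replace (l s) with (proj1_sig (u N) s - (proj1_sig (u N) s - l s)) by ring.
      eapply Rle_trans; [apply Rabs_triang|]. rewrite Rabs_Ropp. lra. }
    exists (exist _ l Hb). intros eps He.
    destruct (Hlim (eps / 2)) as [N HN]; [lra|]. exists N. intros n Hn.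
    apply Rle_lt_trans with (eps / 2); [|lra].
    apply sup_norm_le; [lra|]. intros s. simpl.
    replace (proj1_sig (u n) s + -1 * l s) with (proj1_sig (u n) s - l s) by ring. auto.
Defined.

Lemma linf_cvg_uniform (u : nat -> linf) (l : linf) : bcvg linf u l ->
  forall eps, 0 < eps -> exists N, forall n, (N <= n)%nat ->
    forall s, Rabs (proj1_sig (u n) s - proj1_sig l s) < eps.
Proof.
  intros H eps He. destruct (H eps He) as [N HN]. exists N. intros n Hn s.
  eapply Rle_lt_trans; [|apply (HN n Hn)].
  replace (proj1_sig (u n) s - proj1_sig l s) with (proj1_sig (u n) s + -1 * proj1_sig l s) by ring.
  apply (sup_norm_ge (bsub (u n) l) s).
Qed.

End Linf.

(** * The twisted sum attached to a null family of pairs *)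

Lemma eventually_forall_list (I : Type) (P : I -> nat -> Prop) (F : list I) :
  (forall i, In i F -> exists N, forall p, (N <= p)%nat -> P i p) ->
  exists N, forall i, In i F -> forall p, (N <= p)%nat -> P i p.
Proof.
  induction F as [|a F IH]; intros H.
  - exists 0%nat. intros i [].
  - destruct IH as [N HN]. { intros i Hi; apply H; right; auto. }
    destruct (H a) as [M HM]; [left; auto|]. exists (Nat.max N M).
    intros i [<-|Hi] p Hp; [apply HM | apply HN; auto]; lia.
Qed.

(** * Null families along an almost disjoint family *)

Definition null_family {I : Type} (m : I -> R) : Prop :=
  forall eta, 0 < eta -> exists F, forall i, eta <= Rabs (m i) -> In i F.

Section Trace.
Variables (I : Type) (A : I -> nat -> Prop).
Hypothesis almost_disjoint : forall i j, i <> j ->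
  exists N, forall p, (N <= p)%nat -> A i p -> A j p -> False.

(* [s] represents, modulo [c_0], the sum of the [m i *: 1_(A i)] in [l_oo / c_0]. *)
Definition trace (m : I -> R) (s : nat -> R) : Prop :=
  (forall i eta, 0 < eta -> exists N, forall p, (N <= p)%nat -> A i p ->
     Rabs (s p - m i) < eta) /\
  (forall eta, 0 < eta -> exists F N, forall p, (N <= p)%nat -> eta <= Rabs (s p) ->
     exists i, In i F /\ A i p).

Lemma list_argmax (m : I -> R) (P : I -> Prop) (F : list I) (i0 : I) : P i0 ->
  exists i, P i /\ Rabs (m i0) <= Rabs (m i) /\
    forall j, In j F -> P j -> Rabs (m j) <= Rabs (m i).
Proof.
  intros H0. induction F as [|a F [i [H1 [H2 H3]]]].
  - exists i0. repeat split; auto. lra. intros j [].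
  - destruct (classic (P a /\ Rabs (m i) <= Rabs (m a))) as [[Ha L]|Hn].
    + exists a. repeat split; auto. lra. intros j [<-|Hj] Pj; [lra|].
      specialize (H3 j Hj Pj). lra.
    + exists i. repeat split; auto. intros j [<-|Hj] Pj; auto.
      apply Rnot_lt_le. intros L. apply Hn. split; auto. lra.
Qed.

(* [s p] is a value [m i] of maximal modulus among the [i] with [A i p]. *)
Lemma trace_exists (m : I -> R) (b : R) : null_family m -> 0 <= b ->
  (forall i, Rabs (m i) <= b) -> exists s, trace m s /\ forall p, Rabs (s p) <= b.
Proof.
  intros Hm Hb Hmb.
  assert (H : forall p, exists r,
    (exists i, A i p /\ r = m i /\ forall j, A j p -> Rabs (m j) <= Rabs (m i)) \/
    (r = 0 /\ forall j, A j p -> m j = 0)).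
  { intros p. destruct (classic (exists i, A i p /\ m i <> 0)) as [[i [Hi Hmi]]|Hn].
    - destruct (Hm (Rabs (m i))) as [F HF]; [apply Rabs_pos_lt; auto|].
      destruct (list_argmax m (fun i => A i p) F i Hi) as [k [H1 [H2 H3]]].
      exists (m k). left. exists k. repeat split; auto. intros j Hj.
      destruct (Rle_dec (Rabs (m i)) (Rabs (m j))); auto. lra.
    - exists 0. right. split; auto. intros j Hj. apply NNPP. intros H. apply Hn. eauto. }
  apply choice in H. destruct H as [s Hs]. exists s. split; [split|].
  - intros i eta Heta.
    (* When [m i <> 0], the threshold [Rabs (m i)] puts in [F] every [j] that could be preferred to
       [i]; almost disjointness excludes these for large [p]. *)
    set (eta' := if Req_dec_T (m i) 0 then eta else Rabs (m i)).
    assert (He' : 0 < eta').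
    { unfold eta'. destruct (Req_dec_T (m i) 0); auto. apply Rabs_pos_lt; auto. }
    destruct (Hm eta' He') as [F HF].
    destruct (eventually_forall_list I (fun j p => j <> i -> A i p -> A j p -> False) F)
      as [N HN].
    { intros j _. destruct (classic (j = i)) as [->|Hne].
      - exists 0%nat. tauto.
      - destruct (almost_disjoint i j) as [N HN]; auto. exists N. eauto. }
    exists N. intros p Hp Hip. destruct (Hs p) as [[j [Hj [-> Hmax]]]|[-> Hz]].
    + destruct (classic (j = i)) as [->|Hne].
      { rewrite Rminus_diag, Rabs_R0. auto. }
      destruct (Rle_dec eta' (Rabs (m j))) as [L|L].
      { exfalso. eapply HN; eauto. }
      specialize (Hmax i Hip). unfold eta' in L. destruct (Req_dec_T (m i) 0) as [E|E].
      * rewrite E, Rminus_0_r. lra.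
      * lra.
    + rewrite (Hz i Hip), Rminus_diag, Rabs_R0. auto.
  - intros eta Heta. destruct (Hm eta Heta) as [F HF]. exists F, 0%nat. intros p _ Hp.
    destruct (Hs p) as [[j [Hj [E Hmax]]]|[E Hz]]; rewrite E in Hp.
    + eauto.
    + rewrite Rabs_R0 in Hp. lra.
  - intros p. destruct (Hs p) as [[j [Hj [-> Hmax]]]|[-> Hz]]; auto. rewrite Rabs_R0. auto.
Qed.

Lemma trace_lin a m s m' s' : trace m s -> trace m' s' ->
  trace (fun i => a * m i + m' i) (fun p => a * s p + s' p).
Proof.
  intros [H1 H2] [H1' H2']. pose proof (Rabs_pos a) as Ha.
  assert (Hpos : forall eta, 0 < eta -> 0 < eta / 2 / (Rabs a + 1)).
  { intros. apply Rdiv_lt_0_compat; lra. }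
  assert (Hsc : forall eta r, 0 < eta -> Rabs r < eta / 2 / (Rabs a + 1) -> Rabs (a * r) < eta / 2).
  { intros eta r He Hr. rewrite Rabs_mult. pose proof (Rabs_pos r).
    apply Rle_lt_trans with ((Rabs a + 1) * Rabs r). { apply Rmult_le_compat_r; lra. }
    apply (Rmult_lt_compat_l (Rabs a + 1)) in Hr; [|lra].
    replace ((Rabs a + 1) * (eta / 2 / (Rabs a + 1))) with (eta / 2) in Hr by (field; lra). auto. }
  split.
  - intros i eta He. destruct (H1 i _ (Hpos eta He)) as [N HN].
    destruct (H1' i (eta / 2)) as [N' HN']; [lra|].
    exists (Nat.max N N'). intros p Hp Hi.
    specialize (HN p ltac:(lia) Hi). specialize (HN' p ltac:(lia) Hi).
    replace (a * s p + s' p - (a * m i + m' i)) with (a * (s p - m i) + (s' p - m' i)) by ring.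
    eapply Rle_lt_trans; [apply Rabs_triang|]. specialize (Hsc eta _ He HN). lra.
  - intros eta He. destruct (H2 _ (Hpos eta He)) as [F [N HN]].
    destruct (H2' (eta / 2)) as [F' [N' HN']]; [lra|].
    exists (F ++ F'), (Nat.max N N'). intros p Hp Hs.
    destruct (Rle_dec (eta / 2 / (Rabs a + 1)) (Rabs (s p))) as [L|L].
    { destruct (HN p) as [i [Hi Hip]]; auto. lia. exists i. rewrite in_app_iff. auto. }
    destruct (Rle_dec (eta / 2) (Rabs (s' p))) as [L'|L'].
    { destruct (HN' p) as [i [Hi Hip]]; auto. lia. exists i. rewrite in_app_iff. auto. }
    exfalso. specialize (Hsc eta (s p) He ltac:(lra)). pose proof (Rabs_triang (a * s p) (s' p)).
    lra.
Qed.

Lemma trace_uniform_closed m s :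
  (forall eps, 0 < eps -> exists m' s', trace m' s' /\
     (forall i, Rabs (m' i - m i) < eps) /\ (forall p, Rabs (s' p - s p) < eps)) -> trace m s.
Proof.
  intros H. split.
  - intros i eta He. destruct (H (eta / 3)) as [m' [s' [[T _] [Hm Hs]]]]; [lra|].
    destruct (T i (eta / 3)) as [N HN]; [lra|]. exists N. intros p Hp Hi.
    specialize (HN p Hp Hi). specialize (Hm i). specialize (Hs p).
    replace (s p - m i) with ((s' p - m' i) + (m' i - m i) - (s' p - s p)) by ring.
    revert HN Hm Hs. unfold Rabs. repeat destruct Rcase_abs; lra.
  - intros eta He. destruct (H (eta / 2)) as [m' [s' [[_ T] [Hm Hs]]]]; [lra|].
    destruct (T (eta / 2)) as [F [N HN]]; [lra|]. exists F, N. intros p Hp Hsp.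
    apply HN; auto. specialize (Hs p).
    revert Hs Hsp. unfold Rabs. repeat destruct Rcase_abs; lra.
Qed.

(** Identifies the kernel of the quotient map with c_0: off finitely many sets [A i] the sequence is
    small by the second clause of [trace], and along each of those by the first. *)
Lemma trace_0 s : trace (fun _ => 0) s <-> in_c0 s.
Proof.
  split.
  - intros [H1 H2] eta He. destruct (H2 eta He) as [F [N HN]].
    destruct (eventually_forall_list I (fun i p => A i p -> Rabs (s p - 0) < eta) F) as [N' HN'].
    { intros i _. destruct (H1 i eta He) as [M HM]. exists M. auto. }
    exists (Nat.max N N'). intros p Hp. unfold Rdist.
    apply Rnot_le_lt. intros L. rewrite Rminus_0_r in L.
    destruct (HN p ltac:(lia) L) as [i [Hi Hip]].
    specialize (HN' i Hi p ltac:(lia) Hip). rewrite Rminus_0_r in HN'. lra.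
  - intros H. split.
    + intros i eta He. destruct (H eta He) as [N HN]. exists N. intros p Hp _. apply HN. auto.
    + intros eta He. destruct (H eta He) as [N HN]. exists [], N. intros p Hp L.
      specialize (HN p Hp). unfold Rdist in HN. rewrite Rminus_0_r in HN. lra.
Qed.

End Trace.

(** * Branches of the tree of finite sequences *)

Definition index : Type := nat * (nat -> nat).

Definition prefix (x : nat -> nat) (k : nat) : list nat := map x (seq 0 k).

(* Empty unless [liminf x = n], so that the nonempty branches are indexed by distinct [x]. *)
Definition branch (i : index) (p : nat) : Prop :=
  liminf_eq (fst i) (snd i) /\ exists k, p = choice.CodeSeq.code (prefix (snd i) k).

Lemma prefix_eq x p : prolongs x p -> prefix x (length p) = p.
Proof.
  intros H. apply nth_ext with (d := 0%nat) (d' := 0%nat).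
  - unfold prefix. rewrite length_map, length_seq. auto.
  - intros n Hn. unfold prefix in *. rewrite length_map, length_seq in Hn.
    rewrite nth_indep with (d' := x 0%nat) by (rewrite length_map, length_seq; auto).
    rewrite map_nth, seq_nth by auto. apply H. auto.
Qed.

Lemma code_inj l m : choice.CodeSeq.code l = choice.CodeSeq.code m -> l = m.
Proof.
  intros H. apply (f_equal choice.CodeSeq.decode) in H.
  rewrite !choice.CodeSeq.codeK in H. auto.
Qed.

Lemma prefix_length x k : length (prefix x k) = k.
Proof. unfold prefix. rewrite length_map. apply length_seq. Qed.

Lemma bounded_initial (g : nat -> nat) a : exists N, forall k, (k <= a)%nat -> (g k < N)%nat.
Proof.
  induction a as [|a [N HN]].
  - exists (S (g 0%nat)). intros k Hk. replace k with 0%nat by lia. lia.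
  - exists (Nat.max N (S (g (S a)))). intros k Hk.
    destruct (Nat.eq_dec k (S a)) as [->|]; [lia|]. specialize (HN k ltac:(lia)). lia.
Qed.

Lemma injective_unbounded (g : nat -> nat) (N : nat) : Injective g ->
  exists k, forall k', (k <= k')%nat -> (N <= g k')%nat.
Proof.
  intros Hg. induction N as [|N [k Hk]].
  - exists 0%nat. intros; lia.
  - destruct (classic (exists k0, g k0 = N)) as [[k0 E]|Hn].
    + exists (Nat.max k (S k0)). intros k' Hk'. specialize (Hk k' ltac:(lia)).
      assert (g k' <> N). { intros E'. rewrite <- E in E'. apply Hg in E'. lia. }
      lia.
    + exists k. intros k' Hk'. specialize (Hk k' Hk').
      assert (g k' <> N) by eauto. lia.
Qed.

(** For the same [x] and different [n], one of the branches is empty. If [x a <> y a], common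
    prefixes have length at most [a], and their codes are bounded. *)
Lemma branch_almost_disjoint i j : i <> j ->
  exists N, forall p, (N <= p)%nat -> branch i p -> branch j p -> False.
Proof.
  destruct i as [n x], j as [m y]. intros Hne.
  destruct (classic (x = y)) as [<-|Hxy].
  - exists 0%nat. intros p _ [H1 _] [H2 _]. simpl in *. apply Hne.
    f_equal. eapply liminf_eq_unique; eauto.
  - assert (Ha : exists a, x a <> y a).
    { apply NNPP. intros H. apply Hxy, functional_extensionality. intros a.
      apply NNPP. eauto. }
    destruct Ha as [a Ha].
    destruct (bounded_initial (fun k => choice.CodeSeq.code (prefix x k)) a) as [N HN].
    exists N. intros p Hp [_ [k E]] [_ [k' E']]. simpl in *.
    rewrite E in E'. apply code_inj in E'.
    assert (k = k') as <- by (rewrite <- (prefix_length x k), E'; apply prefix_length).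
    destruct (Nat.le_gt_cases k a) as [L|L].
    + specialize (HN k L). lia.
    + apply Ha. unfold prefix in E'.
      apply (f_equal (fun l => nth a l (x 0%nat))) in E'.
      rewrite map_nth in E'.
      rewrite nth_indep with (l := map y _) (d' := y 0%nat) in E'
        by (rewrite length_map, length_seq; auto).
      rewrite map_nth, seq_nth in E' by auto. auto.
Qed.

(** * Continuous real functions *)

Section Continuous.
Variables (K : Type) (tau : Topology K).

Lemma continuous_R_const c : continuous_R tau (fun _ => c).
Proof.
  intros k eps He. exists (fun _ => True). split; [apply open_full|]. split; auto.
  intros. rewrite Rminus_diag, Rabs_R0. auto.
Qed.

(** Covers linear combinations, distances and minima at once; for an operation on one function,
    [phi] ignores its second argument. *)
Lemma continuous_R_lipschitz2 (phi : R -> R -> R) (C : R) (f g : K -> R) :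
  (forall a b c d, Rabs (phi a b - phi c d) <= C * (Rabs (a - c) + Rabs (b - d))) ->
  continuous_R tau f -> continuous_R tau g -> continuous_R tau (fun k => phi (f k) (g k)).
Proof.
  intros HC Hf Hg k eps He. pose proof (Rabs_pos C) as HC0.
  assert (He' : 0 < eps / 2 / (Rabs C + 1)) by (apply Rdiv_lt_0_compat; lra).
  destruct (Hf k _ He') as [U [HU [Uk HU']]]. destruct (Hg k _ He') as [V [HV [Vk HV']]].
  exists (fun t => U t /\ V t). split; [apply open_inter; auto|]. split; auto.
  intros y [Uy Vy]. eapply Rle_lt_trans; [apply HC|].
  specialize (HU' y Uy). specialize (HV' y Vy).
  pose proof (Rabs_pos (f y - f k)). pose proof (Rabs_pos (g y - g k)).
  apply Rle_lt_trans with ((Rabs C + 1) * (Rabs (f y - f k) + Rabs (g y - g k))).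
  { apply Rmult_le_compat_r; [lra|]. pose proof (Rle_abs C). lra. }
  replace eps with ((Rabs C + 1) * (eps / 2 / (Rabs C + 1) + eps / 2 / (Rabs C + 1)))
    by (field; lra).
  apply Rmult_lt_compat_l; lra.
Qed.

Lemma continuous_R_lin a f g : continuous_R tau f -> continuous_R tau g ->
  continuous_R tau (fun k => a * f k + g k).
Proof.
  apply continuous_R_lipschitz2 with (phi := fun x y => a * x + y) (C := Rabs a + 1).
  intros x y c d. replace (a * x + y - (a * c + d)) with (a * (x - c) + (y - d)) by ring.
  eapply Rle_trans; [apply Rabs_triang|]. rewrite Rabs_mult.
  pose proof (Rabs_pos a). pose proof (Rabs_pos (x - c)). pose proof (Rabs_pos (y - d)).
  assert (0 <= Rabs a * Rabs (y - d)) by (apply Rmult_le_pos; auto). lra.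
Qed.

Lemma continuous_R_uniform_closed (f : K -> R) :
  (forall eps, 0 < eps -> exists g, continuous_R tau g /\ forall k, Rabs (g k - f k) < eps) ->
  continuous_R tau f.
Proof.
  intros H k eps He. destruct (H (eps / 3)) as [g [Hg Hgf]]; [lra|].
  destruct (Hg k (eps / 3)) as [U [HU [Uk HU']]]; [lra|]. exists U. split; auto. split; auto.
  intros y Uy. specialize (HU' y Uy). pose proof (Hgf y) as H1. pose proof (Hgf k) as H2.
  revert HU' H1 H2. unfold Rabs. repeat destruct Rcase_abs; lra.
Qed.

Lemma continuous_R_bounded (f : K -> R) : compact tau -> continuous_R tau f -> bounded_fun f.
Proof.
  intros Hc Hf.
  destruct (Hc (fun U => is_open tau U /\ exists M, forall y, U y -> Rabs (f y) <= M))
    as [l [Hl1 Hl2]].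
  - intros U [HU _]; auto.
  - intros k. destruct (Hf k 1 Rlt_0_1) as [U [HU [Uk HU']]]. exists U.
    split; auto. split; auto. exists (Rabs (f k) + 1). intros y Uy. specialize (HU' y Uy).
    replace (f y) with (f k + (f y - f k)) by ring.
    eapply Rle_trans; [apply Rabs_triang|]. lra.
  - assert (H : exists M, forall U, In U l -> forall y, U y -> Rabs (f y) <= M).
    { clear Hl2. induction l as [|U l IH].
      - exists 0. intros U [].
      - destruct IH as [M HM]. { intros V HV; apply Hl1; right; auto. }
        destruct (Hl1 U) as [_ [M' HM']]; [left; auto|]. exists (Rmax M M').
        intros V [<-|HV] y Vy.
        + eapply Rle_trans; [apply HM'; auto | apply Rmax_r].
        + eapply Rle_trans; [apply (HM V); auto | apply Rmax_l]. }
    destruct H as [M HM]. exists M. intros y. destruct (Hl2 y) as [U [HU Uy]]. eauto.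
Qed.

Lemma continuous_closed_subspace :
  closed_subspace (linf K) (fun f => continuous_R tau (proj1_sig f)).
Proof.
  split; [|split].
  - exact (continuous_R_const 0).
  - intros a f g Hf Hg. apply continuous_R_lin; auto.
  - intros u l Hu Hl. apply continuous_R_uniform_closed. intros eps He.
    destruct (linf_cvg_uniform K u l Hl eps He) as [N HN]. eauto.
Qed.

End Continuous.

(** * The pull-back space and its nontriviality *)

Section TwistedSum.
Variables (K : Type) (tau : Topology K).
Hypothesis Kcompact : compact tau.
Variables u v : index -> K.
Hypothesis uv_null : forall g, continuous_R tau g -> null_family (fun i => g (u i) - g (v i)).

(* The pull-back of the quotient map [l_oo -> l_oo / c_0] along the operator sending [g] to the sum
   of the [(g (u i) - g (v i)) *: 1_(branch i)]. *)
Definition twisted_space (z : linf (K + nat)) : Prop :=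
  continuous_R tau (fun k => proj1_sig z (inl k)) /\
  trace index branch (fun i => proj1_sig z (inl (u i)) - proj1_sig z (inl (v i)))
    (fun p => proj1_sig z (inr p)).

Lemma trace_ext (m m' : index -> R) s :
  (forall i, m i = m' i) -> trace index branch m s -> trace index branch m' s.
Proof. intros H. replace m' with m; auto. apply functional_extensionality; auto. Qed.

Lemma twisted_closed_subspace : closed_subspace (linf (K + nat)) twisted_space.
Proof.
  split; [|split].
  - split; [exact (continuous_R_const K tau 0)|]. simpl.
    apply trace_ext with (fun _ => 0). { intros; ring. }
    apply trace_0. intros eps He. exists 0%nat. intros. unfold Rdist.
    rewrite Rminus_diag, Rabs_R0. auto.
  - intros a z w [Hz1 Hz2] [Hw1 Hw2]. split.
    + apply (continuous_R_lin K tau a _ _ Hz1 Hw1).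
    + simpl. eapply trace_ext; [|apply (trace_lin _ _ a _ _ _ _ Hz2 Hw2)].
      intros i; simpl; ring.
  - intros z l Hz Hl. pose proof (linf_cvg_uniform _ _ _ Hl) as Hu. split.
    + apply continuous_R_uniform_closed. intros eps He. destruct (Hu eps He) as [N HN].
      exists (fun k => proj1_sig (z N) (inl k)). split; [apply Hz | auto].
    + apply trace_uniform_closed. intros eps He. destruct (Hu (eps / 2)) as [N HN]; [lra|].
      exists (fun i => proj1_sig (z N) (inl (u i)) - proj1_sig (z N) (inl (v i))),
        (fun p => proj1_sig (z N) (inr p)). split; [apply Hz|]. split.
      * intros i. pose proof (HN N (le_n _) (inl (u i))) as H1.
        pose proof (HN N (le_n _) (inl (v i))) as H2.
        revert H1 H2. unfold Rabs. repeat destruct Rcase_abs; lra.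
      * intros p. pose proof (HN N (le_n _) (inr p)). lra.
Qed.

(** A pair (g, s) is stored as one bounded function on the disjoint union [K + nat], so that norm
    and completeness come from [linf]. *)
Definition twisted : Banach := sub_banach (linf (K + nat)) twisted_space twisted_closed_subspace.

Definition twisted_fun (z : twisted) : K + nat -> R := proj1_sig (proj1_sig z).

Definition twisted_quot (z : twisted) (k : K) : R := twisted_fun z (inl k).

Lemma twisted_ext (z w : twisted) : (forall t, twisted_fun z t = twisted_fun w t) -> z = w.
Proof. intros H. apply sig_eq, sig_eq, functional_extensionality. exact H. Qed.

Lemma twisted_build (f : K + nat -> R) : bounded_fun f ->
  continuous_R tau (fun k => f (inl k)) ->
  trace index branch (fun i => f (inl (u i)) - f (inl (v i))) (fun p => f (inr p)) ->
  exists z : twisted, twisted_fun z = f.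
Proof.
  intros Hb Hc Ht.
  exists (exist twisted_space (exist _ f Hb) (conj Hc Ht)). reflexivity.
Qed.

Lemma twisted_inj_exists : exists j : (nat -> R) -> twisted, forall s, in_c0 s ->
  forall t, twisted_fun (j s) t = match t with inl _ => 0 | inr p => s p end.
Proof.
  assert (H : forall s, exists z : twisted, in_c0 s ->
    forall t, twisted_fun z t = match t with inl _ => 0 | inr p => s p end).
  { intros s. destruct (classic (in_c0 s)) as [Hs|Hs].
    (* Outside c_0 the value is arbitrary. *)
    2:{ exists bzero. tauto. }
    destruct (twisted_build (fun t => match t with inl _ => 0 | inr p => s p end)) as [z Hz].
    - destruct (maj_by_pos s) as [M [HM0 HM]].
      + exists 0. exact Hs.
      + exists M. intros [k|p]; auto. rewrite Rabs_R0. lra.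
    - exact (continuous_R_const K tau 0).
    - apply trace_ext with (fun _ => 0). { intros; ring. } apply trace_0. auto.
    - exists z. intros _ t. rewrite Hz. auto. }
  apply choice in H. destruct H as [j Hj]. exists j. auto.
Qed.

(** The second component is the sequence that [trace_exists] attaches to the null family of
    differences; the bound 2 |M| on these bounds it as well. *)
Lemma twisted_quot_surj f : continuous_R tau f ->
  exists z, forall k, twisted_quot z k = f k.
Proof.
  intros Hf. destruct (continuous_R_bounded K tau f Kcompact Hf) as [M HM].
  destruct (trace_exists index branch branch_almost_disjoint
    (fun i => f (u i) - f (v i)) (2 * Rabs M)) as [s [Hs Hsb]].
  - apply uv_null; auto.
  - pose proof (Rabs_pos M). lra.
  - intros i. pose proof (HM (u i)) as H1. pose proof (HM (v i)) as H2.
    pose proof (Rle_abs M). revert H1 H2. unfold Rabs at 1 2 3. repeat destruct Rcase_abs; lra.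
  - destruct (twisted_build (fun t => match t with inl k => f k | inr p => s p end)) as [z Hz];
      auto.
    + exists (2 * Rabs M). intros [k|p]; auto. eapply Rle_trans; [apply HM|].
      pose proof (Rle_abs M). pose proof (Rabs_pos M). lra.
    + exists z. intros k. unfold twisted_quot. rewrite Hz. auto.
Qed.

Lemma twisted_is_twisted_sum (j : (nat -> R) -> twisted) :
  (forall s, in_c0 s -> forall t, twisted_fun (j s) t = match t with inl _ => 0 | inr p => s p end) ->
  twisted_sum tau twisted j twisted_quot.
Proof.
  intros Hj.
  assert (Hlin : forall a s t, in_c0 s -> in_c0 t -> in_c0 (fun n => a * s n + t n)).
  (* For a family consisting of one empty set, the traces of 0 are the null sequences, so linearity
     of traces applies. *)
  { intros a s t Hs Ht. apply (trace_0 unit (fun _ _ => False)).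
    apply (trace_0 unit (fun _ _ => False)) in Hs. apply (trace_0 unit (fun _ _ => False)) in Ht.
    replace (fun _ : unit => 0) with (fun _ : unit => a * 0 + 0).
    - apply trace_lin; auto.
    - apply functional_extensionality. intros; ring. }
  repeat split.
  - intros a s t Hs Ht. apply twisted_ext. intros [k|p].
    + rewrite Hj by auto. change (0 = a * twisted_fun (j s) (inl k) + twisted_fun (j t) (inl k)).
      rewrite !Hj by auto. ring.
    + rewrite Hj by auto.
      change (a * s p + t p = a * twisted_fun (j s) (inr p) + twisted_fun (j t) (inr p)).
      rewrite !Hj by auto. ring.
  - exists 1. intros s b Hs Hb. rewrite Rmult_1_l. apply sup_norm_le.
    + eapply Rle_trans; [apply Rabs_pos | apply (Hb 0%nat)].
    + intros t. change (Rabs (twisted_fun (j s) t) <= b). rewrite Hj by auto.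
      destruct t; auto. rewrite Rabs_R0. eapply Rle_trans; [apply Rabs_pos | apply (Hb 0%nat)].
  - intros s t Hs Ht E n. pose proof (Hj s Hs (inr n)) as H1. rewrite E, Hj in H1; auto.
  - intros z. apply (proj1 (proj2_sig z)).
  - exists 1. intros z k. rewrite Rmult_1_l. apply (sup_norm_ge _ (proj1_sig z) (inl k)).
  - apply twisted_quot_surj.
  - intros Hz. exists (fun p => twisted_fun z (inr p)).
    assert (Hc0 : in_c0 (fun p => twisted_fun z (inr p))).
    { apply (trace_0 index branch). eapply trace_ext; [|apply (proj2_sig z)].
      intros i. change (twisted_quot z (u i) - twisted_quot z (v i) = 0).
      rewrite !Hz. ring. }
    split; auto. apply twisted_ext. intros [k|p]; rewrite Hj; auto. apply Hz.
  - intros [s [Hs ->]] k. unfold twisted_quot. rewrite Hj; auto.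
Qed.

Variable f : index -> K -> R.
Hypothesis f_cont : forall i, continuous_R tau (f i).
Hypothesis f_range : forall i k, 0 <= f i k <= 1.
Hypothesis f_uv : forall i, f i (u i) - f i (v i) = 1.
Hypothesis f_disjoint : forall i j k, fst i <> fst j -> f i k <> 0 -> f j k = 0.

(* A bounded section of the quotient map would be bounded on sums of the [f (n, x n)], which have
   norm at most 1; but the sequence attached to a lifting of [f (n, x)] tends to 1 along the
   branch [x], and [liminf_common_prefix] gives a point where arbitrarily many of these sequences
   exceed 1/2. *)
Lemma twisted_not_complemented (Y : twisted -> Prop) :
  (forall z, (forall k, twisted_quot z k = 0) <-> Y z) -> ~ complemented twisted Y.
Proof.
  intros HY [W [W0 [Wlin [Wcl [Wsum Wint]]]]].
  assert (HW : closed_subspace twisted W) by (repeat split; auto).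
  (* Restricted to the complement [W], the quotient map becomes a bounded bijection [T] onto C(K);
     the constant [C] will bound its inverse. *)
  set (WB := sub_banach twisted W HW).
  set (CK := sub_banach (linf K) _ (continuous_closed_subspace K tau)).
  assert (HT : exists T : WB -> CK, forall w k,
    proj1_sig (proj1_sig (T w)) k = twisted_quot (proj1_sig w) k).
  { apply (choice (fun (w : WB) (g : CK) => forall k,
      proj1_sig (proj1_sig g) k = twisted_quot (proj1_sig w) k)).
    intros w. assert (Hc : continuous_R tau (twisted_quot (proj1_sig w)))
      by apply (proj1 (proj2_sig (proj1_sig w))).
    exists (exist _ (exist _ _ (continuous_R_bounded K tau _ Kcompact Hc)) Hc).
    reflexivity. }
  destruct HT as [T HT].
  assert (Text : forall g h : CK, (forall k, proj1_sig (proj1_sig g) k = proj1_sig (proj1_sig h) k) ->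
    g = h).
  { intros g h H. apply sig_eq, sig_eq, functional_extensionality. exact H. }
  assert (Wlift : forall g, continuous_R tau g ->
    exists w : WB, forall k, twisted_quot (proj1_sig w) k = g k).
  { intros g Hg. destruct (twisted_quot_surj g Hg) as [z Hz].
    destruct (Wsum z) as [y [w [Hy [Hw ->]]]]. exists (exist _ w Hw). intros k. simpl.
    rewrite <- (Hz k). pose proof (proj2 (HY y) Hy k) as H.
    change (twisted_quot w k = twisted_quot y k + twisted_quot w k). lra. }
  destruct (bounded_inverse WB CK T) as [C HC].
  - intros a x y. apply Text. intros k. rewrite HT.
    change (a * twisted_quot (proj1_sig x) k + twisted_quot (proj1_sig y) k =
      a * proj1_sig (proj1_sig (T x)) k + proj1_sig (proj1_sig (T y)) k).
    rewrite !HT. reflexivity.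
  - intros g. destruct (Wlift _ (proj2_sig g)) as [w Hw]. exists w. apply Text.
    intros k. rewrite HT. apply Hw.
  - exists 1. intros w. rewrite Rmult_1_l. apply sup_norm_le; [apply bnorm_ge0|].
    intros k. rewrite HT. apply (sup_norm_ge _ (proj1_sig (proj1_sig w)) (inl k)).
  - intros w Hw. apply sig_eq. apply Wint; [|apply (proj2_sig w)].
    apply HY. intros k. rewrite <- HT, Hw. reflexivity.
  - assert (Hw : exists w : index -> WB, forall i k, twisted_quot (proj1_sig (w i)) k = f i k).
    { apply (choice (fun i (w : WB) => forall k, twisted_quot (proj1_sig w) k = f i k)).
      intros i. apply Wlift. auto. }
    destruct Hw as [w Hw].
    set (val := fun (z : WB) (p : list nat) =>
      twisted_fun (proj1_sig z) (inr (choice.CodeSeq.code p))).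
    assert (Hk : exists k : index -> nat, forall i, liminf_eq (fst i) (snd i) ->
      forall k', (k i <= k')%nat -> / 2 < val (w i) (prefix (snd i) k')).
    { apply (choice (fun i k => liminf_eq (fst i) (snd i) ->
        forall k', (k <= k')%nat -> / 2 < val (w i) (prefix (snd i) k'))).
      intros i. destruct (classic (liminf_eq (fst i) (snd i))) as [Hi|Hi].
      2:{ exists 0%nat. tauto. }
      (* Since [f_uv] gives the difference 1, the first clause of [trace] with tolerance 1/2 keeps
         the values along the branch above 1/2 from some prefix on. *)
      destruct (proj1 (proj2 (proj2_sig (proj1_sig (w i)))) i (/ 2)) as [N HN]; [lra|].
      destruct (injective_unbounded (fun k => choice.CodeSeq.code (prefix (snd i) k)) N)
        as [k Hk].
      { intros a b E. apply code_inj in E. rewrite <- (prefix_length (snd i) a), E.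
        apply prefix_length. }
      exists k. intros _ k' Hk'. specialize (HN _ (Hk k' Hk')).
      specialize (HN ltac:(split; eauto)).
      change (Rabs (val (w i) (prefix (snd i) k') -
        (twisted_quot (proj1_sig (w i)) (u i) - twisted_quot (proj1_sig (w i)) (v i))) < / 2) in HN.
      rewrite !Hw, f_uv in HN. revert HN. unfold Rabs. destruct Rcase_abs; lra. }
    destruct Hk as [k Hk].
    (* The lift of a sum of [m] functions will be at least m/2 > |C| at the common node, while its
       image has norm at most 1. *)
    destruct (INR_unbounded (2 * Rabs C)) as [m Hm].
    destruct (liminf_common_prefix (fun n x => k (n, x)) m) as [p Hp].
    assert (Hx : exists x : nat -> nat -> nat, forall n, (n < m)%nat ->
      / 2 < val (w (n, x n)) p).
    { apply (choice (fun n x => (n < m)%nat -> / 2 < val (w (n, x)) p)). intros n.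
      destruct (Nat.lt_ge_cases n m) as [L|L]; [|exists (fun _ => 0%nat); lia].
      destruct (Hp n L) as [x [H1 [H2 H3]]]. exists x. intros _.
      specialize (Hk (n, x) H1 (length p) H3). simpl in Hk.
      rewrite prefix_eq in Hk; auto. }
    destruct Hx as [x Hx].
    set (s := fix s n : WB := match n with
      | O => bzero | S n' => badd (s n') (w (n', x n')) end).
    assert (Hval : forall n, (n <= m)%nat -> INR n / 2 <= val (s n) p).
    { induction n as [|n IH]; intros Hn.
      - change (INR 0 / 2 <= 0). simpl. lra.
      - rewrite S_INR. specialize (IH ltac:(lia)). specialize (Hx n Hn).
        change (val (s (S n)) p) with (val (s n) p + val (w (n, x n)) p). lra. }
    (* The second clause records an earlier summand that is nonzero at [t], so that [f_disjoint]
       makes the new one vanish there. *)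
    assert (Hq : forall t n, 0 <= twisted_quot (proj1_sig (s n)) t <= 1 /\
      (twisted_quot (proj1_sig (s n)) t <> 0 -> exists l, (l < n)%nat /\ f (l, x l) t <> 0)).
    { intros t. induction n as [|n [IH1 IH2]].
      - change (twisted_quot (proj1_sig (s 0%nat)) t) with 0. split; [lra|]. intros H; lra.
      - replace (twisted_quot (proj1_sig (s (S n))) t)
          with (twisted_quot (proj1_sig (s n)) t + f (n, x n) t).
        2:{ rewrite <- Hw. reflexivity. }
        pose proof (f_range (n, x n) t).
        destruct (Req_dec (twisted_quot (proj1_sig (s n)) t) 0) as [E|E].
        + rewrite E, Rplus_0_l. split; auto. intros H'. exists n. split; auto.
        + destruct (IH2 E) as [l [Hl1 Hl2]].
          rewrite (f_disjoint (l, x l) (n, x n)); auto; [|simpl; lia].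
          rewrite Rplus_0_r. split; auto. intros _. exists l. split; auto. }
    specialize (HC (s m)). specialize (Hval m (le_n _)).
    assert (H1 : val (s m) p <= bnorm (s m)).
    { eapply Rle_trans; [apply Rle_abs|].
      apply (sup_norm_ge _ (proj1_sig (proj1_sig (s m))) (inr (choice.CodeSeq.code p))). }
    assert (H2 : bnorm (T (s m)) <= 1).
    { apply sup_norm_le; [lra|]. intros t. rewrite HT.
      destruct (Hq t m) as [[? ?] _]. rewrite Rabs_right; lra. }
    assert (H3 : C * bnorm (T (s m)) <= Rabs C * 1).
    { pose proof (bnorm_ge0 _ (T (s m))).
      apply Rle_trans with (Rabs C * bnorm (T (s m))).
      - apply Rmult_le_compat_r; auto. apply Rle_abs.
      - apply Rmult_le_compat_l; auto. apply Rabs_pos. }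
    lra.
Qed.

Lemma nontrivial_from_null_pairs : nontrivial_twisted_sum_c0_CK tau.
Proof.
  destruct twisted_inj_exists as [j Hj].
  pose proof (twisted_is_twisted_sum j Hj) as H.
  exists twisted, j, twisted_quot. split; auto.
  apply twisted_not_complemented. apply H.
Qed.

End TwistedSum.

(** * Pairs of points in a Valdivia compactum *)

(** The code of [[a; b; c]] stands for the interval around (a - b) / (c + 1) of radius 2 / (c + 1).
    Integer indices allow boxes to be counted; the factor 2 leaves room for rounding the centre
    up. *)
Definition center (k : nat) : R :=
  let l := choice.CodeSeq.decode k in
  (INR (nth 0 l 0%nat) - INR (nth 1 l 0%nat)) / (INR (nth 2 l 0%nat) + 1).

Definition radius (k : nat) : R := 2 / (INR (nth 2 (choice.CodeSeq.decode k) 0%nat) + 1).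

Lemma small_rational_interval (r eps : R) : 0 < eps ->
  exists k, Rabs (r - center k) < radius k /\ radius k < eps.
Proof.
  intros He. destruct (INR_unbounded (2 / eps)) as [c Hc].
  pose proof (pos_INR c) as Hc0.
  destruct (archimed (r * (INR c + 1))) as [H1 H2]. set (z := up (r * (INR c + 1))) in *.
  assert (Hab : exists a b : nat, IZR z = INR a - INR b).
  { exists (Z.to_nat z), (Z.to_nat (- z)). rewrite !INR_IZR_INZ, <- minus_IZR. f_equal. lia. }
  destruct Hab as [a [b Hz]].
  exists (choice.CodeSeq.code [a; b; c]). unfold center, radius.
  rewrite choice.CodeSeq.codeK. simpl nth. rewrite <- Hz. split.
  - replace (r - IZR z / (INR c + 1)) with (- ((IZR z - r * (INR c + 1)) / (INR c + 1)))
      by (field; lra).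
    assert (0 < / (INR c + 1)) by (apply Rinv_0_lt_compat; lra).
    rewrite Rabs_Ropp, Rabs_right.
    + unfold Rdiv. apply Rmult_lt_compat_r; lra.
    + apply Rle_ge. unfold Rdiv. apply Rmult_le_pos; lra.
  - apply (Rmult_lt_reg_r (INR c + 1)); [lra|].
    replace (2 / (INR c + 1) * (INR c + 1)) with 2 by (field; lra).
    apply (Rmult_lt_compat_l eps) in Hc; auto.
    replace (eps * (2 / eps)) with 2 in Hc by (field; lra). lra.
Qed.

Section Opens.
Variables (K : Type) (tau : Topology K).

Lemma open_local (U : K -> Prop) :
  (forall t, U t -> exists V, is_open tau V /\ V t /\ forall s, V s -> U s) -> is_open tau U.
Proof.
  intros H. apply open_ext with (fun t => exists V, (is_open tau V /\ forall s, V s -> U s) /\ V t).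
  - intros t. split.
    + intros [V [[_ HV] Vt]]. auto.
    + intros Ut. destruct (H t Ut) as [V [H1 [H2 H3]]]. exists V. auto.
  - apply open_union. intros V [HV _]. auto.
Qed.

Lemma open_lt (g : K -> R) (a : R) : continuous_R tau g -> is_open tau (fun t => g t < a).
Proof.
  intros Hg. apply open_local. intros t Ht. destruct (Hg t (a - g t)) as [V [H1 [H2 H3]]]; [lra|].
  exists V. repeat split; auto. intros s Hs. specialize (H3 s Hs).
  pose proof (Rle_abs (g s - g t)). lra.
Qed.

Lemma continuous_R_dist (g : K -> R) (c : R) : continuous_R tau g ->
  continuous_R tau (fun t => Rabs (g t - c)).
Proof.
  intros Hg. apply (continuous_R_lipschitz2 K tau (fun x _ => Rabs (x - c)) 1 g g); auto.
  intros x y z w. pose proof (Rabs_pos (y - w)).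
  unfold Rabs in *. repeat destruct Rcase_abs; lra.
Qed.

Lemma open_neq0 (g : K -> R) : continuous_R tau g -> is_open tau (fun t => g t <> 0).
Proof.
  intros Hg. apply open_local. intros t Ht.
  destruct (Hg t (Rabs (g t))) as [V [H1 [H2 H3]]]; [apply Rabs_pos_lt; auto|].
  exists V. repeat split; auto. intros s Vs E. specialize (H3 s Vs).
  rewrite E, Rminus_0_l, Rabs_Ropp in H3. lra.
Qed.

End Opens.

Lemma countable_enum (I : Type) (i0 : I) (D : I -> Prop) : countable_set D ->
  exists g : nat -> I, forall i, D i -> exists n, g n = i.
Proof.
  intros [f Hf]. exists (fun n => epsilon (inhabits i0) (fun i => D i /\ f i = n)).
  intros i Hi. exists (f i).
  destruct (epsilon_spec (inhabits i0) (fun j => D j /\ f j = f i)) as [H1 H2]; eauto.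
Qed.

(** * Coordinates of a compact space *)

Section Valdivia.
Variables (K : Type) (tau : Topology K).
Hypothesis Kcompact : compact tau.
Variables (I : Type) (i0 : I) (phi : K -> I -> R).
Hypothesis phi_cont : forall i, continuous_R tau (fun k => phi k i).
Hypothesis phi_inj : forall s t, (forall i, phi s i = phi t i) -> s = t.
Hypothesis phi_dense : dense tau (fun k => Sigma_pt (phi k)).

Lemma phi_separates s t : s <> t -> exists i, phi s i <> phi t i.
Proof.
  intros H. apply NNPP. intros Hn. apply H, phi_inj. intros i. apply NNPP. eauto.
Qed.

Definition box (l : list (I * nat)) (t : K) : Prop :=
  forall i k, In (i, k) l -> Rabs (phi t i - center k) < radius k.

Lemma box_open l : is_open tau (box l).
Proof.
  induction l as [|[i k] l IH].
  - apply open_ext with (fun _ => True); [|apply open_full].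
    intros t. split; auto. intros _ i k [].
  - apply open_ext with (fun t => Rabs (phi t i - center k) < radius k /\ box l t).
    + intros t. split.
      * intros [H1 H2] j m [E|Hj]; [|auto]. injection E as <- <-. auto.
      * intros H. split; [apply H; left; auto|]. intros j m Hj. apply H. right; auto.
    + apply open_inter; auto. apply open_lt. apply continuous_R_dist. auto.
Qed.

(* Compactness makes the topology of [K] the one induced by [phi]; [J] bounds the coordinates
   used. *)
Lemma box_inside (J : I -> Prop) (y : K) (U : K -> Prop) : is_open tau U ->
  (forall t, U t \/ exists i, J i /\ phi t i <> phi y i) ->
  exists l, (forall i k, In (i, k) l -> J i) /\ box l y /\ forall t, box l t -> U t.
Proof.
  intros HU Hcov.
  (* A member of the cover either lies in [U] or misses, in some coordinate from [J], a rational
     interval containing that coordinate of [y]. *)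
  destruct (Kcompact (fun V => is_open tau V /\ ((forall t, V t -> U t) \/
    exists i k, J i /\ Rabs (phi y i - center k) < radius k /\
      forall t, V t -> ~ Rabs (phi t i - center k) < radius k))) as [L [HL1 HL2]].
  - intros V [HV _]; auto.
  - intros t. destruct (Hcov t) as [Ut|[i [Ji Hi]]].
    + exists U. auto.
    (* A third leaves room for the variation on [V], the offset of the centre and the radius. *)
    + set (e := Rabs (phi t i - phi y i) / 3).
      assert (He : 0 < e).
      { unfold e. assert (0 < Rabs (phi t i - phi y i)); [|lra].
        apply Rabs_pos_lt. lra. }
      destruct (small_rational_interval (phi y i) e He) as [k [Hk1 Hk2]].
      destruct (phi_cont i t e He) as [V [HV [Vt HV']]].
      exists V. split; auto. split; auto. right. exists i, k. split; auto. split; auto.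
      intros s Vs Hs. specialize (HV' s Vs). simpl in HV'. unfold e in *.
      revert He Hk1 Hk2 HV' Hs. unfold Rabs. repeat destruct Rcase_abs; lra.
  - assert (H : exists l, (forall i k, In (i, k) l -> J i) /\ box l y /\
      forall V, In V L -> forall t, V t -> box l t -> U t).
    { clear HL2. induction L as [|V L IH].
      - exists []. split; [intros i k []|]. split; [intros i k []|]. intros V [].
      - destruct IH as [l [H1 [H2 H3]]]. { intros W HW. apply HL1. right; auto. }
        destruct (HL1 V) as [_ [HVU|[i [k [Ji [Hy Hk]]]]]]; [left; auto| |].
        + exists l. split; auto. split; auto. intros W [<-|HW] t Wt Hb; eauto.
        + exists ((i, k) :: l). split; [|split].
          * intros j m [E|Hj]; eauto. injection E as <- <-. auto.
          * intros j m [E|Hj]; auto. injection E as <- <-. auto.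
          * intros W [<-|HW] t Wt Hb.
            { exfalso. apply (Hk t Wt). apply Hb. left; auto. }
            apply (H3 W HW t Wt). intros j m Hj. apply Hb. right; auto. }
    destruct H as [l [H1 [H2 H3]]]. exists l. split; auto. split; auto.
    intros t Ht. destruct (HL2 t) as [V [HV Vt]]. eauto.
Qed.

(** Finitely many boxes on which [g] oscillates by less than [eta] cover [K], and two points that
    agree on the coordinates of these boxes lie in a common one. *)
Lemma continuous_finitely_determined (g : K -> R) (eta : R) : continuous_R tau g -> 0 < eta ->
  exists F : list I, forall s t, (forall i, In i F -> phi s i = phi t i) -> Rabs (g s - g t) < eta.
Proof.
  intros Hg He.
  destruct (Kcompact (fun V => exists l, V = box l /\
    forall s t, box l s -> box l t -> Rabs (g s - g t) < eta)) as [L [HL1 HL2]].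
  - intros V [l [-> _]]. apply box_open.
  - intros k. destruct (Hg k (eta / 2)) as [U [HU [Uk HU']]]; [lra|].
    destruct (box_inside (fun _ => True) k U HU) as [l [_ [H2 H3]]].
    { intros t. destruct (classic (t = k)) as [->|Hne]; auto. right.
      destruct (phi_separates t k Hne) as [i Hi]. eauto. }
    exists (box l). split; auto. exists l. split; auto. intros s t Hs Ht.
    pose proof (HU' s (H3 s Hs)) as A. pose proof (HU' t (H3 t Ht)) as B.
    revert A B. unfold Rabs. repeat destruct Rcase_abs; lra.
  - assert (H : exists F : list I, forall V, In V L -> forall s t,
      (forall i, In i F -> phi s i = phi t i) -> V s -> Rabs (g s - g t) < eta).
    { clear HL2. induction L as [|V L IH].
      - exists []. intros V [].
      - destruct IH as [F IH]. { intros W HW. apply HL1. right; auto. }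
        destruct (HL1 V) as [l [-> Hl]]; [left; auto|]. exists (map fst l ++ F).
        intros W [<-|HW] s t Hst Ws.
        + apply Hl; auto. intros i k Hi. rewrite <- Hst; auto.
          apply in_or_app. left. apply (in_map fst _ _ Hi).
        + apply (IH W HW); auto. intros i Hi. apply Hst, in_or_app. auto. }
    destruct H as [F HF]. exists F. intros s t Hst. destruct (HL2 s) as [V [HV Vs]]. eauto.
Qed.

(** Each of the countably many open sets contains a box around [x], which uses finitely many
    coordinates; together these determine [x]. *)
Lemma Gdelta_coordinates (x : K) : Gdelta_point tau x ->
  exists c : nat -> I, forall t, (forall n, phi t (c n) = phi x (c n)) -> t = x.
Proof.
  intros [U [HU Hx]].
  assert (H : forall n, exists l, box l x /\ forall t, box l t -> U n t).
  { intros n. destruct (box_inside (fun _ => True) x (U n) (HU n)) as [l [_ [H2 H3]]]; eauto.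
    intros t. destruct (classic (t = x)) as [->|Hne].
    - left. apply Hx. auto.
    - right. destruct (phi_separates t x Hne) as [i Hi]. eauto. }
  apply choice in H. destruct H as [l Hl].
  exists (fun m => match choice.CodeSeq.decode m with
    | [n; j] => fst (nth j (l n) (i0, 0%nat)) | _ => i0 end).
  intros t Ht. apply Hx. intros n. apply (proj2 (Hl n)). intros i k Hi.
  destruct (In_nth _ _ (i0, 0%nat) Hi) as [j [_ Ej]].
  specialize (Ht (choice.CodeSeq.code [n; j])). rewrite choice.CodeSeq.codeK, Ej in Ht.
  simpl in Ht. rewrite Ht. apply (proj1 (Hl n)). auto.
Qed.

(** * A gauge vanishing only at the G_delta point *)

Section Gauge.
Variables (x : K) (c : nat -> I).
Hypothesis c_separates : forall t, (forall n, phi t (c n) = phi x (c n)) -> t = x.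

(** The gauge is the supremum over n of |phi t (c n) - phi x (c n)| truncated at 1 / (n + 1). The
    truncation makes all but finitely many terms uniformly small, whence continuity. The last
    property makes [h] invariant under the retraction, which fixes the coordinates [c n]. *)
Lemma gauge_exists : exists h : K -> R,
  continuous_R tau h /\ (forall t, 0 <= h t) /\ (forall t, h t = 0 <-> t = x) /\
  (forall s t, (forall n, phi s (c n) = phi t (c n)) -> h s = h t).
Proof.
  set (d := fun n t => Rmin (/ (INR n + 1)) (Rabs (phi t (c n) - phi x (c n)))).
  assert (Hi : forall n, 0 < / (INR n + 1) <= 1).
  { intros n. pose proof (pos_INR n). split; [apply Rinv_0_lt_compat; lra|].
    rewrite <- Rinv_1. apply Rinv_le_contravar; lra. }
  assert (Hd0 : forall n t, 0 <= d n t).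
  { intros n t. apply Rmin_glb; [specialize (Hi n); lra | apply Rabs_pos]. }
  assert (Hd1 : forall n t, d n t <= / (INR n + 1)) by (intros; apply Rmin_l).
  assert (H : forall t, exists r, is_lub (fun r => exists n, r = d n t) r).
  { intros t. destruct (completeness (fun r => exists n, r = d n t)) as [r Hr].
    - exists 1. intros r [n ->]. specialize (Hd1 n t). specialize (Hi n). lra.
    - exists (d 0%nat t), 0%nat. reflexivity.
    - exists r. exact Hr. }
  apply choice in H. destruct H as [h Hh].
  assert (Hge : forall n t, d n t <= h t) by (intros n t; apply (Hh t); eauto).
  exists h. split; [|split; [|split]].
  - intros k eps He. destruct (INR_unbounded (2 / eps)) as [N HN].
    assert (Htail : forall n, (N <= n)%nat -> / (INR n + 1) < eps / 2).
    { intros n Hn. apply le_INR in Hn. pose proof (pos_INR N).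
      apply Rmult_lt_reg_l with (INR n + 1); [lra|]. rewrite Rinv_r by lra.
      assert (Hn' : 2 / eps < INR n + 1) by lra.
      apply (Rmult_lt_compat_r (eps / 2)) in Hn'; [|lra].
      replace (2 / eps * (eps / 2)) with 1 in Hn' by (field; lra). lra. }
    assert (HU : forall m, exists U, is_open tau U /\ U k /\
      forall y, U y -> forall n, (n < m)%nat -> Rabs (phi y (c n) - phi k (c n)) < eps / 2).
    { induction m as [|m [U [H1 [H2 H3]]]].
      - exists (fun _ => True). split; [apply open_full|]. split; auto. intros; lia.
      - destruct (phi_cont (c m) k (eps / 2)) as [V [V1 [V2 V3]]]; [lra|].
        exists (fun t => U t /\ V t). split; [apply open_inter; auto|]. split; auto.
        intros y [Uy Vy] n Hn. destruct (Nat.eq_dec n m) as [->|]; auto. apply H3; auto. lia. }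
    destruct (HU N) as [U [H1 [H2 H3]]]. exists U. split; auto. split; auto.
    intros y Uy.
    assert (Hdd : forall n, Rabs (d n y - d n k) <= eps / 2).
    { intros n. destruct (Nat.lt_ge_cases n N) as [L|L].
      - specialize (H3 y Uy n L). revert H3. unfold d, Rmin.
        repeat destruct Rle_dec; unfold Rabs in *; repeat destruct Rcase_abs; lra.
      - specialize (Htail n L). pose proof (Hd0 n y). pose proof (Hd0 n k).
        pose proof (Hd1 n y). pose proof (Hd1 n k).
        unfold Rabs; destruct Rcase_abs; lra. }
    assert (A1 : h y <= h k + eps / 2).
    { apply (Hh y). intros r [n ->]. specialize (Hdd n). specialize (Hge n k).
      pose proof (Rle_abs (d n y - d n k)). lra. }
    assert (A2 : h k <= h y + eps / 2).
    { apply (Hh k). intros r [n ->]. specialize (Hdd n). specialize (Hge n y).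
      rewrite Rabs_minus_sym in Hdd. pose proof (Rle_abs (d n k - d n y)). lra. }
    unfold Rabs; destruct Rcase_abs; lra.
  - intros t. eapply Rle_trans; [apply (Hd0 0%nat) | apply Hge].
  - intros t. split.
    + intros E. apply c_separates. intros n. specialize (Hge n t). specialize (Hd0 n t).
      assert (E' : d n t = 0) by lra. unfold d in E'. specialize (Hi n).
      revert E'. unfold Rmin. destruct Rle_dec; intros E'; [lra|].
      apply NNPP. intros Hne. assert (0 < Rabs (phi t (c n) - phi x (c n))); [|lra].
      apply Rabs_pos_lt. lra.
    + intros ->. apply Rle_antisym; [|eapply Rle_trans; [apply (Hd0 0%nat) | apply Hge]].
      apply (Hh x). intros r [n ->]. unfold d. rewrite Rminus_diag, Rabs_R0. apply Rmin_r.
  - intros s t Hst. apply (is_lub_u (fun r => exists n, r = d n s)); auto.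
    replace (fun r => exists n, r = d n s) with (fun r => exists n, r = d n t); auto.
    apply functional_extensionality. intros r. apply propositional_extensionality.
    unfold d. split; intros [n ->]; exists n; rewrite Hst; auto.
Qed.

Variable h : K -> R.
Hypothesis h_cont : continuous_R tau h.
Hypothesis h_ge0 : forall t, 0 <= h t.
Hypothesis h_eq0 : forall t, h t = 0 <-> t = x.
Hypothesis h_coord : forall s t, (forall n, phi s (c n) = phi t (c n)) -> h s = h t.

(** By compactness [h], which vanishes only at [x], has a positive lower bound off [U]. *)
Lemma gauge_neighborhood (U : K -> Prop) : is_open tau U -> U x ->
  exists e, 0 < e /\ forall t, h t < e -> U t.
Proof.
  intros HU Ux.
  destruct (Kcompact (fun V => is_open tau V /\ ((forall t, V t -> U t) \/
    exists e, 0 < e /\ forall t, V t -> e <= h t))) as [L [HL1 HL2]].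
  - intros V [HV _]; auto.
  - intros t. destruct (classic (t = x)) as [->|Hne].
    + exists U. auto.
    + assert (Ht : 0 < h t).
      { pose proof (h_ge0 t). assert (h t <> 0) by (rewrite h_eq0; auto). lra. }
      destruct (h_cont t (h t / 2)) as [V [V1 [V2 V3]]]; [lra|].
      exists V. split; auto. split; auto. right. exists (h t / 2). split; [lra|].
      intros s Vs. specialize (V3 s Vs). revert V3. unfold Rabs. destruct Rcase_abs; lra.
  - assert (H : exists e, 0 < e /\ forall V, In V L -> forall t, V t -> h t < e -> U t).
    { clear HL2. induction L as [|V L IH].
      - exists 1. split; [lra|]. intros V [].
      - destruct IH as [e [He IH]]. { intros W HW; apply HL1; right; auto. }
        destruct (HL1 V) as [_ [HV|[e' [He' HV]]]]; [left; auto| |].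
        + exists e. split; auto. intros W [<-|HW] t Wt Ht; eauto.
        + exists (Rmin e e'). split; [apply Rmin_pos; auto|].
          intros W [<-|HW] t Wt Ht.
          * exfalso. specialize (HV t Wt). pose proof (Rmin_r e e'). lra.
          * apply (IH W HW t Wt). pose proof (Rmin_l e e'). lra. }
    destruct H as [e [He H]]. exists e. split; auto. intros t Ht.
    destruct (HL2 t) as [V [HV Vt]]. eauto.
Qed.

(** * Maximal families of pairs *)

Definition dif (p : K * K) (i : I) : Prop := phi (fst p) i <> phi (snd p) i.

(** Equal gauges place both points of a pair in one annulus. Countable difference sets keep the
    number of generated coordinates under control, and their disjointness lets a finite set of
    coordinates separate only finitely many pairs. *)
Definition pair_family (e : R) (P : K * K -> Prop) : Prop :=
  (forall p, P p -> fst p <> snd p /\ h (fst p) = h (snd p) /\ h (fst p) < e /\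
     countable_set (dif p)) /\
  (forall p q i, P p -> P q -> dif p i -> dif q i -> p = q).

Lemma maximal_pair_family e : exists P, pair_family e P /\
  forall Q, pair_family e Q -> (forall p, P p -> Q p) -> forall p, Q p -> P p.
Proof.
  assert (H0 : pair_family e (fun _ => False)) by (split; intros; tauto).
  destruct (zorn_preorder {P | pair_family e P} (exist _ _ H0)
    (fun P Q => forall p, proj1_sig P p -> proj1_sig Q p)) as [[P HP] Hmax]; auto.
  - intros F HF.
    assert (Hu : pair_family e (fun p => exists P, F P /\ proj1_sig P p)).
    { split.
      - intros p [P [_ Pp]]. apply (proj2_sig P); auto.
      - intros p q i [P [FP Pp]] [Q [FQ Qq]] Hp Hq.
        destruct (HF P Q FP FQ) as [L|L].
        + apply (proj2 (proj2_sig Q)) with i; auto.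
        + apply (proj2 (proj2_sig P)) with i; auto. }
    exists (exist _ _ Hu). intros P FP p Pp. exists P; auto.
  - exists P. split; auto. intros Q HQ HPQ. apply (Hmax (exist _ Q HQ) HPQ).
Qed.

(** * Coordinates generated by a maximal family *)

Section Closure.
Variables (e : R) (P : K * K -> Prop).
Hypothesis P_family : pair_family e P.
Hypothesis P_maximal :
  forall Q, pair_family e Q -> (forall p, P p -> Q p) -> forall p, Q p -> P p.

Variable enum_dif : {p | P p} -> nat -> I.
Hypothesis enum_difP : forall p i, dif (proj1_sig p) i -> exists n, enum_dif p n = i.

(** Later instantiated with points of the dense Sigma-subset, whose supports are countable; adding
    these supports to the generated coordinates keeps the retraction inside [K]. *)
Variable pt : list (I * nat) -> K.
Variable enum_supp : list (I * nat) -> nat -> I.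
Hypothesis ptP : forall l, (exists t, box l t) -> box l (pt l) /\
  forall i, phi (pt l) i <> 0 -> exists n, enum_supp l n = i.

(* The coordinates generated from those of [h] and of the pairs in [P] by adding the supports of
   the points [pt l]. Terms of this generation are finitely branching trees over [P], so there
   are at most [max (#|P|, aleph_0)] of them. *)
Definition term : Type := choice.GenTree.tree (nat + {p | P p} * nat).

(** The label of a node codes a list whose head selects a coordinate in the enumerated support and
    whose tail gives the intervals of the box; the children give the coordinates of the box. *)
Fixpoint coord (s : term) : I :=
  match s with
  | choice.GenTree.Leaf (inl n) => c n
  | choice.GenTree.Leaf (inr (p, n)) => enum_dif p n
  | choice.GenTree.Node n ss =>
      enum_supp (combine (map coord ss) (tl (choice.CodeSeq.decode n)))
        (hd 0%nat (choice.CodeSeq.decode n))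
  end.

Definition generated (i : I) : Prop := exists s, coord s = i.

Lemma generated_terms (l : list (I * nat)) : (forall i k, In (i, k) l -> generated i) ->
  exists ss, combine (map coord ss) (map snd l) = l.
Proof.
  induction l as [|[i k] l IH]; intros H.
  - exists []. reflexivity.
  - destruct IH as [ss Hss]. { intros j m Hj. apply (H j m). right; auto. }
    destruct (H i k) as [s Hs]; [left; auto|]. exists (s :: ss). simpl.
    rewrite Hs, Hss. reflexivity.
Qed.

Lemma generated_supp l n : (forall i k, In (i, k) l -> generated i) ->
  generated (enum_supp l n).
Proof.
  intros H. destruct (generated_terms l H) as [ss Hss].
  exists (choice.GenTree.Node (choice.CodeSeq.code (n :: map snd l)) ss).
  change (coord (choice.GenTree.Node (choice.CodeSeq.code (n :: map snd l)) ss)) with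
    (enum_supp (combine (map coord ss)
      (tl (choice.CodeSeq.decode (choice.CodeSeq.code (n :: map snd l)))))
      (hd 0%nat (choice.CodeSeq.decode (choice.CodeSeq.code (n :: map snd l))))).
  rewrite choice.CodeSeq.codeK. simpl tl. rewrite Hss. reflexivity.
Qed.

(** Otherwise compactness yields a box around [t], on generated coordinates only, all of whose
    points have a nonzero ungenerated coordinate; but the chosen point of that box has generated
    support. *)
Lemma retraction t : exists t',
  (forall i, generated i -> phi t' i = phi t i) /\ (forall i, ~ generated i -> phi t' i = 0).
Proof.
  apply NNPP. intros Hno.
  destruct (box_inside generated t (fun t' => exists i, ~ generated i /\ phi t' i <> 0))
    as [l [H1 [H2 H3]]].
  - apply open_local. intros t' [i [Hi Ht']].
    exists (fun s => phi s i <> 0). split; [apply open_neq0; auto|]. eauto.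
  - intros t'. apply NNPP. intros H. apply Hno. exists t'. split.
    + intros i Hi. apply NNPP. intros Hne. apply H. right. eauto.
    + intros i Hi. apply NNPP. intros Hne. apply H. left. eauto.
  - destruct (ptP l) as [H4 H5]; eauto. destruct (H3 (pt l) H4) as [i [Hi Hne]].
    destruct (H5 i Hne) as [n <-]. apply Hi. apply generated_supp; auto.
Qed.

Lemma generated_c n : generated (c n).
Proof. exists (choice.GenTree.Leaf (inl n)). reflexivity. Qed.

(** By density a counterexample can be replaced by a point [a] of the Sigma-subset. Then [a] and its
    retract have the same gauge and differ only at ungenerated coordinates in the countable support
    of [a], so maximality puts the pair in [P], which makes those coordinates generated. *)
Lemma supported_near t : h t < e -> forall i, ~ generated i -> phi t i = 0.
Proof.
  intros Ht i Hi. apply NNPP. intros Hne.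
  destruct (phi_dense (fun s => h s < e /\ phi s i <> 0)) as [a [[Ha1 Hai] Ha3]].
  - apply open_inter; [apply open_lt | apply open_neq0]; auto.
  - exists t; auto.
  - destruct (retraction a) as [a' [H1 H2]].
    assert (Hd : forall j, dif (a, a') j -> ~ generated j /\ phi a j <> 0).
    { intros j Hj. unfold dif in Hj. simpl in Hj.
      assert (Hg : ~ generated j) by (intros Hg; apply Hj; rewrite H1; auto).
      split; auto. rewrite (H2 j Hg) in Hj. auto. }
    assert (HP : P (a, a')).
    { apply (P_maximal (fun p => P p \/ p = (a, a'))); auto. split.
      - intros p [Pp| ->]; [apply P_family; auto|]. simpl. split; [|split; [|split]]; auto.
        + intros <-. apply Hai, H2. auto.
        + apply h_coord. intros n. symmetry. apply H1. apply generated_c.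
        + destruct Ha3 as [g Hg]. exists g. intros j k Hj Hk. apply Hg; apply Hd; auto.
      - assert (Hdis : forall p j, P p -> dif p j -> dif (a, a') j -> False).
        { intros p j Pp Hj Hj'. destruct (Hd j Hj') as [Hg _]. apply Hg.
          destruct (enum_difP (exist _ p Pp) j Hj) as [n Hn].
          exists (choice.GenTree.Leaf (inr (exist _ p Pp, n))). exact Hn. }
        intros p q j [Pp| ->] [Pq| ->] Hp Hq; auto.
        + apply (proj2 P_family) with j; auto.
        + exfalso; eauto.
        + exfalso; eauto. }
    assert (Hda : dif (a, a') i). { unfold dif. simpl. rewrite (H2 i Hi). auto. }
    destruct (enum_difP (exist _ _ HP) i Hda) as [n Hn]. apply Hi.
    exists (choice.GenTree.Leaf (inr (exist _ _ HP, n))). exact Hn.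
Qed.

(** Terms are used a second time, as indices of boxes on generated coordinates, so that a single
    count bounds the size of a base. *)
Definition term_box (s : term) : list (I * nat) :=
  match s with
  | choice.GenTree.Leaf _ => []
  | choice.GenTree.Node n ss => combine (map coord ss) (choice.CodeSeq.decode n)
  end.

Lemma term_base : subspace_base tau (fun t => h t < e)
  (fun W => exists s, W = fun t => box (term_box s) t /\ h t < e).
Proof.
  split.
  - intros W [s ->]. exists (box (term_box s)). split; [apply box_open|]. intros t. tauto.
  - intros U HU y Uy Hy.
    (* Adding to [U] the points with a nonzero ungenerated coordinate changes nothing where
       [h t < e], and then the generated coordinates suffice to separate [y] from the remaining
       points. *)
    destruct (box_inside generated y (fun t => U t \/ exists i, ~ generated i /\ phi t i <> 0))
      as [l [H1 [H2 H3]]].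
    + apply open_local. intros t [Ut|[i [Hi Ht]]].
      * exists U. auto.
      * exists (fun s => phi s i <> 0). split; [apply open_neq0; auto|]. eauto.
    + intros t. destruct (classic (t = y)) as [->|Hne]; auto.
      destruct (phi_separates t y Hne) as [i Hi].
      destruct (classic (generated i)) as [Hg|Hg]; eauto.
      left. right. exists i. split; auto. rewrite (supported_near y Hy i Hg) in Hi. auto.
    + destruct (generated_terms l H1) as [ss Hss].
      exists (fun t => box l t /\ h t < e). split; [|split]; auto.
      * exists (choice.GenTree.Node (choice.CodeSeq.code (map snd l)) ss).
        unfold term_box. rewrite choice.CodeSeq.codeK, Hss. reflexivity.
      * intros t [Ht1 Ht2]. split; auto. destruct (H3 t Ht1) as [Ut|[i [Hi Hne]]]; auto.
        exfalso. apply Hne. apply supported_near; auto.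
Qed.

End Closure.

(** Trees are coded by lists of symbols, and [list_embeds] applies to the infinite type
    [nat + T]. *)
Lemma terms_embed (T : Type) :
  embeds (choice.GenTree.tree (nat + T * nat)) (nat + T).
Proof.
  assert (Hl : embeds (list (nat + T)) (nat + T)).
  { apply list_embeds. exists inl. intros a b E. congruence. }
  apply embeds_trans with (list (nat + (nat + T * nat))).
  { exists (@choice.GenTree.encode _). intros s t E.
    apply (f_equal (@choice.GenTree.decode _)) in E.
    rewrite !choice.GenTree.codeK in E. congruence. }
  apply embeds_trans with (list (nat + T)); auto. apply embeds_list.
  apply embeds_trans with (list (nat + T)); auto.
  (* The three kinds of symbols become lists of distinct shapes. *)
  exists (fun z => match z with
    | inl n => [inl n]
    | inr (inl n) => [inl n; inl n]
    | inr (inr (p, n)) => [inr p; inl n] end).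
  intros [n|[n|[p n]]] [m|[m|[q m]]] E; congruence.
Qed.

(** * Continuum many pairs in each annulus *)

Hypothesis x_weight : local_weight_ge_c tau x.

(** The base of [term_base] is indexed by terms, which embed in [nat + {p | P p}], while the weight
    at [x] demands continuum many members. *)
Lemma continuum_embeds_family e P : 0 < e -> pair_family e P ->
  (forall Q, pair_family e Q -> (forall p, P p -> Q p) -> forall p, Q p -> P p) ->
  embeds R (nat + {p | P p}).
Proof.
  intros He HP Hmax.
  assert (H1 : exists en : {p | P p} -> nat -> I, forall p i, dif (proj1_sig p) i ->
    exists n, en p n = i).
  { apply (choice (fun (p : {p | P p}) g => forall i, dif (proj1_sig p) i -> exists n, g n = i)).
    intros [p Pp]. apply countable_enum; auto. apply HP. auto. }
  destruct H1 as [en Hen].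
  assert (H2 : forall l, exists q : K * (nat -> I), (exists t, box l t) -> box l (fst q) /\
    forall i, phi (fst q) i <> 0 -> exists n, snd q n = i).
  { intros l. destruct (classic (exists t, box l t)) as [Hl|Hl].
    - destruct (phi_dense (box l) (box_open l) Hl) as [a [Ha1 Ha2]].
      destruct (countable_enum I i0 _ Ha2) as [g Hg]. exists (a, g). auto.
    - exists (x, fun _ => i0). tauto. }
  apply choice in H2. destruct H2 as [q Hq].
  pose proof (term_base e P HP Hmax en Hen (fun l => fst (q l)) (fun l => snd (q l)) Hq) as Hb.
  destruct (x_weight (fun t => h t < e)) with (2 := Hb) as [f [Hf1 Hf2]].
  { exists (fun t => h t < e). split; [apply open_lt; auto|]. split; auto.
    rewrite (proj2 (h_eq0 x)); auto. }
  apply choice in Hf1. destruct Hf1 as [s Hs].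
  apply embeds_trans with (term P); [|apply terms_embed].
  exists s. intros a b E. apply Hf2. rewrite (Hs a), (Hs b), E. intros t; tauto.
Qed.

Lemma annulus_pairs e : 0 < e -> exists d (g : (nat -> nat) -> K * K), 0 < d /\
  (forall y, fst (g y) <> snd (g y) /\ h (fst (g y)) = h (snd (g y)) /\ d < h (fst (g y)) < e) /\
  (forall y z i, dif (g y) i -> dif (g z) i -> y = z).
Proof.
  intros He. destruct (maximal_pair_family e) as [P [HP Hmax]].
  (* Even classes hold one integer each; the class 2 m + 1 collects the pairs of gauge above 1 / (m
     + 1). *)
  destruct (continuum_pigeonhole (nat + {p | P p}) (fun n z => match z with
    | inl m => n = (2 * m)%nat
    | inr p => exists m, n = (2 * m + 1)%nat /\ / (INR m + 1) < h (fst (proj1_sig p)) end))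
    as [n [g [Hg Hn]]].
  - eapply embeds_trans; [apply embeds_baire_R|]. eapply continuum_embeds_family; eauto.
  - intros [m|[p Pp]]; [eauto|]. simpl.
    destruct (proj1 HP p Pp) as [H1 [H2 [H3 H4]]].
    assert (H5 : 0 < h (fst p)).
    { pose proof (h_ge0 (fst p)). assert (h (fst p) <> 0); [|lra].
      intros E. apply H1. rewrite E in H2. symmetry in H2.
      apply h_eq0 in E. apply h_eq0 in H2. congruence. }
    destruct (INR_unbounded (/ h (fst p))) as [m Hm].
    exists (2 * m + 1)%nat, m. split; auto.
    rewrite <- (Rinv_inv (h (fst p))). apply Rinv_lt_contravar; [|lra].
    apply Rmult_lt_0_compat; [apply Rinv_0_lt_compat; auto|]. pose proof (pos_INR m). lra.
  (* An even class has only one element, so the class found is odd. *)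
  - assert (Hodd : exists m, n = (2 * m + 1)%nat).
    { assert (Hne : g (fun _ => 0%nat) <> g (fun _ => 1%nat)).
      { intros E. apply Hg in E. apply (f_equal (fun w => w 0%nat)) in E. discriminate. }
      pose proof (Hn (fun _ => 0%nat)) as A. pose proof (Hn (fun _ => 1%nat)) as B.
      destruct (g (fun _ => 0%nat)) as [a|p]; [|destruct A as [m [A _]]; eauto].
      destruct (g (fun _ => 1%nat)) as [b|p]; [|destruct B as [m [B _]]; eauto].
      exfalso. apply Hne. f_equal. lia. }
    destruct Hodd as [m ->].
    assert (Hp : forall y, exists p, g y = inr p /\ / (INR m + 1) < h (fst (proj1_sig p))).
    { intros y. specialize (Hn y). destruct (g y) as [a|p]; [lia|].
      destruct Hn as [m' [E Hm']]. assert (m' = m) as -> by lia. eauto. }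
    apply choice in Hp. destruct Hp as [G HG].
    exists (/ (INR m + 1)), (fun y => proj1_sig (G y)). split; [|split].
    + apply Rinv_0_lt_compat. pose proof (pos_INR m). lra.
    + intros y. destruct (proj1 HP _ (proj2_sig (G y))) as [H1 [H2 [H3 _]]].
      repeat split; auto. apply HG.
    + intros y z i Hy Hz. apply Hg. rewrite (proj1 (HG y)), (proj1 (HG z)). f_equal.
      apply sig_eq. apply (proj2 HP) with i; auto; apply proj2_sig.
Qed.

Lemma annuli : exists (e : nat -> R) (g : nat -> (nat -> nat) -> K * K),
  (forall n, e (S n) < e n) /\ (forall n, e n <= (/ 2) ^ n) /\
  (forall n y, fst (g n y) <> snd (g n y) /\ h (fst (g n y)) = h (snd (g n y)) /\
     e (S n) < h (fst (g n y)) < e n) /\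
  (forall n y z i, dif (g n y) i -> dif (g n z) i -> y = z).
Proof.
  assert (H : forall e, exists dg : R * ((nat -> nat) -> K * K), 0 < e ->
    0 < fst dg /\
    (forall y, fst (snd dg y) <> snd (snd dg y) /\ h (fst (snd dg y)) = h (snd (snd dg y)) /\
       fst dg < h (fst (snd dg y)) < e) /\
    (forall y z i, dif (snd dg y) i -> dif (snd dg z) i -> y = z)).
  { intros e. destruct (classic (0 < e)) as [He|He].
    - destruct (annulus_pairs e He) as [d [g Hdg]]. exists (d, g). auto.
    - exists (0, fun _ => (x, x)). tauto. }
  apply choice in H. destruct H as [D HD].
  (* The bound supplied for [e m] leaves its pairs above the next radius; halving makes the radii
     tend to 0. *)
  set (e := fix e n := match n with O => 1 | S m => Rmin (fst (D (e m))) (e m / 2) end).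
  assert (He : forall n, 0 < e n).
  { induction n as [|n IH]; simpl; [lra|]. apply Rmin_pos; [|lra]. apply HD; auto. }
  exists e, (fun n => snd (D (e n))). split; [|split; [|split]].
  - intros n. specialize (He n). simpl. pose proof (Rmin_r (fst (D (e n))) (e n / 2)). lra.
  - induction n as [|n IH]; simpl; [lra|]. pose proof (Rmin_r (fst (D (e n))) (e n / 2)). lra.
  - intros n y. destruct (HD (e n) (He n)) as [_ [H _]]. destruct (H y) as [H1 [H2 H3]].
    repeat split; auto; [|apply H3]. simpl. pose proof (Rmin_l (fst (D (e n))) (e n / 2)). lra.
  - intros n. apply HD. auto.
Qed.

(** The minimum of a tent function of [h] peaking at [h u], which vanishes outside the annulus, and
    of the distance of a separating coordinate from its value at [v], scaled to be 1 at [u]. *)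
Lemma bump_exists (u v : K) (a b : R) : u <> v -> h u = h v -> a < h u < b ->
  exists f, continuous_R tau f /\ (forall t, 0 <= f t <= 1) /\ f u - f v = 1 /\
    forall t, f t <> 0 -> a < h t < b.
Proof.
  intros Huv Hh Hab. destruct (phi_separates u v Huv) as [i Hi].
  set (r := Rmin (h u - a) (b - h u)). assert (Hr : 0 < r) by (apply Rmin_pos; lra).
  set (s := Rabs (phi u i - phi v i)). assert (Hs : 0 < s) by (apply Rabs_pos_lt; lra).
  assert (Hr' : 0 < / r) by (apply Rinv_0_lt_compat; auto).
  assert (Hs' : 0 < / s) by (apply Rinv_0_lt_compat; auto).
  exists (fun t => Rmin (Rmax 0 (1 - / r * Rabs (h t - h u))) (/ s * Rabs (phi t i - phi v i))).
  split; [|split; [|split]].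
  - assert (Hsc : forall w g, continuous_R tau g -> continuous_R tau (fun t => w * g t)).
    { intros w g Hg. apply (continuous_R_lipschitz2 K tau (fun y _ => w * y) (Rabs w) g g); auto.
      intros y y' z z'. rewrite <- Rmult_minus_distr_l, Rabs_mult.
      apply Rmult_le_compat_l; [apply Rabs_pos|]. pose proof (Rabs_pos (y' - z')). lra. }
    apply (continuous_R_lipschitz2 K tau (fun y z => Rmin (Rmax 0 (1 - y)) z) 1
      (fun t => / r * Rabs (h t - h u)) (fun t => / s * Rabs (phi t i - phi v i))).
    + intros y y' z z'. unfold Rmin, Rmax. repeat destruct Rle_dec;
        unfold Rabs; repeat destruct Rcase_abs; lra.
    + apply Hsc, continuous_R_dist; auto.
    + apply Hsc, continuous_R_dist; auto.
  - intros t. assert (0 <= / r * Rabs (h t - h u)) by (apply Rmult_le_pos; [lra|apply Rabs_pos]).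
    assert (0 <= / s * Rabs (phi t i - phi v i)) by (apply Rmult_le_pos; [lra|apply Rabs_pos]).
    unfold Rmin, Rmax. repeat destruct Rle_dec; lra.
  - fold s. rewrite <- Hh, !Rminus_diag, !Rabs_R0, !Rmult_0_r, Rinv_l, Rminus_0_r by lra.
    unfold Rmin, Rmax. repeat destruct Rle_dec; lra.
  - intros t Ht.
    assert (H : / r * Rabs (h t - h u) < 1).
    { apply Rnot_le_lt. intros L. apply Ht.
      assert (0 <= / s * Rabs (phi t i - phi v i)) by (apply Rmult_le_pos; [lra|apply Rabs_pos]).
      unfold Rmin, Rmax. repeat destruct Rle_dec; lra. }
    apply (Rmult_lt_compat_l r) in H; auto.
    rewrite <- Rmult_assoc, Rinv_r, Rmult_1_l, Rmult_1_r in H by lra.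
    pose proof (Rmin_l (h u - a) (b - h u)) as A. pose proof (Rmin_r (h u - a) (b - h u)) as B.
    fold r in A, B. revert H. unfold Rabs. destruct Rcase_abs; lra.
Qed.

Lemma nontrivial_at_gauge : nontrivial_twisted_sum_c0_CK tau.
Proof.
  destruct annuli as [e [g [He [He2 [Hg1 Hg2]]]]].
  assert (Hmono : forall m n, (m <= n)%nat -> e n <= e m).
  { induction 1 as [|n _ IH]; [lra|]. specialize (He n). lra. }
  set (u := fun i : index => fst (g (fst i) (snd i))).
  set (v := fun i : index => snd (g (fst i) (snd i))).
  assert (Hf : forall i : index, exists f, continuous_R tau f /\ (forall t, 0 <= f t <= 1) /\
    f (u i) - f (v i) = 1 /\ forall t, f t <> 0 -> e (S (fst i)) < h t < e (fst i)).
  { intros [n y]. destruct (Hg1 n y) as [H1 [H2 H3]]. apply bump_exists; auto. }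
  apply choice in Hf. destruct Hf as [f Hf].
  apply (nontrivial_from_null_pairs K tau Kcompact u v) with (f := f).
  (* For large n both points are close to [x]. For the other n, a difference of at least [eta]
     requires a separating coordinate in [F]. *)
  - intros k Hk eta Heta.
    destruct (continuous_finitely_determined k eta Hk Heta) as [F HF].
    destruct (Hk x (eta / 2)) as [U [HU [Ux HU']]]; [lra|].
    destruct (gauge_neighborhood U HU Ux) as [e' [He' HUe]].
    destruct (pow_lt_1_zero (/ 2)) with (y := e') as [N HN]; auto.
    { rewrite Rabs_right; lra. }
    (* For given n, a coordinate separates at most one pair, so [epsilon] picks the only possible
       [y]; if there is none, the entry is harmless. *)
    exists (map (fun ni => (fst ni, epsilon (inhabits (fun _ => 0%nat))
      (fun y => dif (g (fst ni) y) (snd ni)))) (list_prod (seq 0 N) F)).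
    intros [n y] Hny.
    assert (HnN : (n < N)%nat).
    { apply Nat.nle_gt. intros L. specialize (HN n L).
      destruct (Hg1 n y) as [_ [H2 [_ H3]]]. pose proof (He2 n) as H4.
      assert (0 < (/ 2) ^ n) by (apply pow_lt; lra). rewrite Rabs_right in HN by lra.
      pose proof (HU' (u (n, y)) (HUe (u (n, y)) ltac:(unfold u; simpl; lra))) as A.
      pose proof (HU' (v (n, y)) (HUe (v (n, y)) ltac:(unfold v; simpl; lra))) as B.
      revert Hny A B. unfold Rabs. repeat destruct Rcase_abs; lra. }
    assert (Hi : exists i, In i F /\ dif (g n y) i).
    { apply NNPP. intros Hno. apply Rle_not_lt in Hny. apply Hny, HF. intros i Hi.
      apply NNPP. intros Hne. apply Hno. exists i. auto. }
    destruct Hi as [i [HiF Hi]]. apply in_map_iff. exists (n, i). split.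
    + simpl. f_equal. apply (Hg2 n _ _ i); auto.
      apply (epsilon_spec (inhabits (fun _ => 0%nat)) (fun y => dif (g n y) i)). eauto.
    + apply in_prod; auto. apply in_seq. lia.
  - apply Hf.
  - apply Hf.
  - apply Hf.
  - intros i j k Hij Hk. apply NNPP. intros Hk'.
    apply (proj2 (proj2 (proj2 (Hf i)))) in Hk. apply (proj2 (proj2 (proj2 (Hf j)))) in Hk'.
    destruct (Nat.lt_total (fst i) (fst j)) as [L|[L|L]]; auto.
    + specialize (Hmono (S (fst i)) (fst j) L). lra.
    + specialize (Hmono (S (fst j)) (fst i) L). lra.
Qed.

End Gauge.

Lemma nontrivial_coordinates (x : K) : Gdelta_point tau x -> local_weight_ge_c tau x ->
  nontrivial_twisted_sum_c0_CK tau.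
Proof.
  intros HG Hw. destruct (Gdelta_coordinates x HG) as [c Hc].
  destruct (gauge_exists x c Hc) as [h [H1 [H2 [H3 H4]]]].
  apply (nontrivial_at_gauge x c h); auto.
Qed.

End Valdivia.

(** * Valdivia compacta and the Continuum Hypothesis *)

Lemma nontrivial_local_weight (K : Type) (tau : Topology K) (x : K) :
  valdivia tau -> Gdelta_point tau x -> local_weight_ge_c tau x ->
  nontrivial_twisted_sum_c0_CK tau.
Proof.
  intros [Hc [_ [I [phi [H1 [H2 H3]]]]]].
  (* The extra null coordinate makes the index set nonempty. *)
  apply (nontrivial_coordinates K tau Hc (option I) None
    (fun t o => match o with Some i => phi t i | None => 0 end)).
  - intros [i|]; [apply H1 | apply continuous_R_const].
  - intros s t H. apply H2. intros i. apply (H (Some i)).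
  - intros U HU HUn. destruct (H3 U HU HUn) as [t [Ut [f Hf]]]. exists t. split; auto.
    exists (fun o => match o with Some i => f i | None => 0%nat end).
    intros [i|] [j|] Hi Hj E; try tauto. f_equal. auto.
Qed.

(** By comparability, a base either receives an injection of the reals or injects into them. In the
    second case CH makes the image countable, against the hypothesis, or gives a copy of the reals
    in it, which is pulled back to the base. *)
Lemma weight_ge_c_CH (K : Type) (tau : Topology K) (V : K -> Prop) (x : K) :
  CH -> V x -> ~ second_countable_sub tau V -> weight_ge_c tau V.
Proof.
  intros Hch Vx HV B HB.
  assert (Hinj : embeds R {W | B W} ->
    exists f : R -> K -> Prop, (forall r, B (f r)) /\ (forall r s, set_eq (f r) (f s) -> r = s)).
  { intros [f Hf]. exists (fun r => proj1_sig (f r)). split; [intros r; apply proj2_sig|].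
    intros r s E. apply Hf, sig_eq, functional_extensionality. intros t.
    apply propositional_extensionality, E. }
  destruct (embeds_comparable R {W | B W}) as [H|[f Hf]]; auto.
  destruct (Hch (fun r => exists W, f W = r)) as [[g Hg]|[g [Hg1 Hg2]]].
  - exfalso. apply HV.
    (* The point [x] makes the base nonempty, which provides the default value of the
       enumeration. *)
    destruct (proj2 HB (fun _ => True) (open_full _ tau) x) as [W0 [HW0 _]]; auto.
    destruct (countable_enum {W | B W} (exist _ W0 HW0) (fun _ => True)) as [k Hk].
    { exists (fun W => g (f W)). intros W W' _ _ E. apply Hf, Hg; eauto. }
    exists (fun n => proj1_sig (k n)).
    replace (fun W => exists n, W = proj1_sig (k n)) with B; auto.
    apply functional_extensionality. intros W. apply propositional_extensionality. split.
    + intros HW. destruct (Hk (exist _ W HW)) as [n Hn]; auto. exists n. rewrite Hn. reflexivity.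
    + intros [n ->]. apply proj2_sig.
  - apply Hinj. apply choice in Hg1. destruct Hg1 as [W HW]. exists W. intros r s E.
    apply Hg2. rewrite <- (HW r), <- (HW s), E. reflexivity.
Qed.

Theorem theorem3p3 :
  (forall (K : Type) (tau : Topology K) (x : K),
      valdivia tau -> Gdelta_point tau x -> local_weight_ge_c tau x ->
      nontrivial_twisted_sum_c0_CK tau) /\
  (CH ->
   forall (K : Type) (tau : Topology K) (x : K),
      valdivia tau -> Gdelta_point tau x ->
      (forall V, neighborhood tau V x -> ~ second_countable_sub tau V) ->
      nontrivial_twisted_sum_c0_CK tau).
Proof.
  split.
  - apply nontrivial_local_weight.
  - intros Hch K tau x Hv HG Hx. apply (nontrivial_local_weight K tau x); auto.
    intros V HV. apply (weight_ge_c_CH K tau V x Hch); auto.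
    destruct HV as [U [_ [Ux HU]]]. auto.
Qed.
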